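(* Let $\mathfrak g$ be a simple Lie algebra over an algebraically closed field of characteristic $0$ with Cartan subalgebra $\mathfrak h$, root system $\Delta$ and Weyl group $W$. Let $w\in W$ be a quasiregular element of order $m$, and suppose $w$ has a lift $\sigma$ of the same order $m$ in the normalizer of $\mathfrak h$ in the adjoint group of $\mathfrak g$. Then $$\frac{|\Delta|}{m}=\dim\mathfrak g^{\sigma}-\dim\mathfrak h^{w},$$ where $\mathfrak g^\sigma$ is the fixed point set of $\sigma$ in $\mathfrak g$ and $\mathfrak h^w$ the fixed point set of $w$ in $\mathfrak h$.
   Context: An element $w\in W$ of order $m$ is quasiregular if for every divisor $s$ of $m$ with $s<m$, the element $w^s$ fixes no root. A lift of $w$ is an element of the normalizer of $\mathfrak h$ in the adjoint group whose induced action on $\mathfrak h$ is $w$. *)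

(* Defs.v *)
From HB Require Import structures.
From mathcomp Require Import all_boot all_order all_algebra all_field.
Set Implicit Arguments. Unset Strict Implicit. Unset Printing Implicit Defensive.
Import GRing.Theory.
Local Open Scope ring_scope.


Definition lpow (F : fieldType) (V : vectType F) (f : 'End(V)) (k : nat) : 'End(V) :=
  iter k (fun g => (f \o g)%VF) \1%VF.

Section Lie.
Variables (F : fieldType) (L : vectType F) (br : L -> L -> L).

Definition lie_bracket : Prop :=
  [/\ (forall (a : F) x y z, br (a *: x + y) z = a *: br x z + br y z),
      (forall (a : F) x y z, br z (a *: x + y) = a *: br z x + br z y),
      (forall x, br x x = 0) &
      (forall x y z, br x (br y z) + br y (br z x) + br z (br x y) = 0)].

Definition lie_ideal (I : {vspace L}) : Prop :=
  forall x y, y \in I -> br x y \in I.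

Definition simple_lie : Prop :=
  (exists x y, br x y != 0) /\
  forall I : {vspace L}, lie_ideal I -> I = 0%VS \/ I = fullv.

Definition lie_subalgebra (h : {vspace L}) : Prop :=
  forall x y, x \in h -> y \in h -> br x y \in h.

Definition bracket_space (A B : {vspace L}) : {vspace L} :=
  <<[seq br x y | x <- vbasis A, y <- vbasis B]>>%VS.

Fixpoint lcs (h : {vspace L}) (k : nat) : {vspace L} :=
  if k is k'.+1 then bracket_space h (lcs h k') else h.

Definition nilpotent_subalgebra (h : {vspace L}) : Prop :=
  lie_subalgebra h /\ exists n, lcs h n = 0%VS.

Definition self_normalizing (h : {vspace L}) : Prop :=
  forall x, (forall y, y \in h -> br x y \in h) -> x \in h.

Definition cartan_subalgebra (h : {vspace L}) : Prop :=
  nilpotent_subalgebra h /\ self_normalizing h.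

Section Roots.
Variable h : {vspace L}.
Local Notation H := (subvs_of h).

Definition weight_vector (alpha : 'Hom(H, F^o)) (x : L) : Prop :=
  forall t : H, br (vsval t) x = (alpha t : F) *: x.

Definition is_root (alpha : 'Hom(H, F^o)) : Prop :=
  alpha != 0 /\ exists x, x != 0 /\ weight_vector alpha x.

Definition is_coroot (alpha : 'Hom(H, F^o)) (ha : H) : Prop :=
  (alpha ha : F) = 2 /\
  exists e f, [/\ weight_vector alpha e, weight_vector (- alpha) f &
                  br e f = vsval ha].

Definition reflection (alpha : 'Hom(H, F^o)) (ha : H) : 'End(H) :=
  linfun (fun t : H => t - (alpha t : F) *: ha).

Definition in_weyl (w : 'End(H)) : Prop :=
  exists s : seq ('Hom(H, F^o) * H),
    (forall p, p \in s -> is_root p.1 /\ is_coroot p.1 p.2) /\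
    w = foldr (fun p acc => (reflection p.1 p.2 \o acc)%VF) \1%VF s.

(* w of order m is quasiregular: for every divisor s < m of m,
   w^s fixes no root (W acts on h^* by beta |-> beta o w^-1) *)
Definition quasiregular (w : 'End(H)) (m : nat) : Prop :=
  forall s, (s %| m)%N -> (s < m)%N ->
    forall beta, is_root beta -> (beta \o lpow w s)%VF != beta.

End Roots.

Definition ad (x : L) : 'End(L) := linfun (br x).

Definition ad_nilpotent (x : L) : Prop := exists n, lpow (ad x) n = 0.

(* exp(ad x) for ad-nilpotent x (ad x ^+ (dim L) = 0, so the sum is exact) *)
Definition exp_ad (x : L) : 'End(L) :=
  \sum_(k < (\dim {:L}).+1) (k`!%:R : F)^-1 *: lpow (ad x) k.

Definition in_adjoint_group (sigma : 'End(L)) : Prop :=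
  exists s : seq L, (forall x, x \in s -> ad_nilpotent x) /\
    sigma = foldr (fun x acc => (exp_ad x \o acc)%VF) \1%VF s.

End Lie.

Definition has_order (F : fieldType) (V : vectType F) (f : 'End(V)) (m : nat) : Prop :=
  (0 < m)%N /\ lpow f m = \1%VF /\ forall k, (0 < k < m)%N -> lpow f k != \1%VF.

(* Main.v *)
(* Let [g] be the sum of the weight spaces of [h].  Since [w] is quasiregular, for
   [0 < k < m] the power [sigma ^ k] permutes the root spaces without fixed point, so
   it has the same trace on [g] as [w ^ k] has on [h].  As
   [m dim g^sigma = \sum_(k < m) tr (sigma ^ k)] and likewise for [w], the difference
   [m (dim g^sigma - dim h^w)] is the total dimension of the root spaces, and each root
   space is a line.

   That last fact and the nondegeneracy of the Killing form are obtained from traces of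
   [ad t] on sums of generalized weight spaces, with no Jordan decomposition: if [t = [e, f]] with [e], [f] of weights [alpha],
   [- alpha], then [ad t] has trace [0] on each [alpha]-string, so every weight
   takes at [t] a rational multiple of [alpha t]. *)
Require Import Defs.
From HB Require Import structures.
From mathcomp Require Import all_boot all_order all_algebra all_field.
From mathcomp Require Import boolp ring.
Import GRing.Theory.
Local Open Scope ring_scope.
Set Implicit Arguments.
Unset Strict Implicit.

(** * Traces, Fitting projections, eigenvectors *)

(** A Cartan subalgebra is here only nilpotent and self-normalizing, so [h] may not be assumed
    abelian or diagonalizable. Traces ignore the nilpotent part of [ad t] on a generalized weight
    space, so weights can be computed with as if [h] acted by scalars; genuine weight vectors are
    recovered by Engel's theorem. Rationality of the weights at [[e, f]] makes up for the absence of
    an order on [F]: up to nonzero squares, [killing t t] becomes a sum of natural numbers, which in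
    characteristic 0 vanishes only term by term. *)

Lemma lfunZ (F : fieldType) (U V : vectType F) (f : 'Hom(U, V)) a x :
  f (a *: x) = a *: f x.
Proof. exact: linearZ. Qed.

Section Powers.
Variables (F : fieldType) (V : vectType F).
Implicit Types (f g : 'End(V)) (x : V).

Lemma lpow0E f x : lpow f 0 x = x.
Proof. exact: id_lfunE. Qed.

Lemma lpowSE f k x : lpow f k.+1 x = f (lpow f k x).
Proof. exact: comp_lfunE. Qed.

Lemma lpowDE f k l x : lpow f (k + l) x = lpow f k (lpow f l x).
Proof. by elim: k => [|k IH]; rewrite ?lpow0E // addSn !lpowSE IH. Qed.

Lemma lpowSrE f k x : lpow f k.+1 x = lpow f k (f x).
Proof. by rewrite -addn1 lpowDE lpowSE lpow0E. Qed.

Lemma lpow_eq0_leq f k l x : (k <= l)%N -> lpow f k x = 0 -> lpow f l x = 0.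
Proof. by move=> kl e; rewrite -(subnK kl) lpowDE e linear0. Qed.

Lemma lpow_comm f g : (forall x, f (g x) = g (f x)) ->
  forall k x, lpow f k (g x) = g (lpow f k x).
Proof. by move=> c; elim=> [|k IH] x; rewrite ?lpow0E // !lpowSE IH c. Qed.

(** The kernels of the powers increase, a repetition is permanent, and each strict step gains a
    dimension; so the chain is stationary from [\dim {:V}] on. This replaces unknown nilpotency
    exponents by a uniform one. *)
Lemma lpow_eq0_dim f k x : lpow f k x = 0 -> lpow f (\dim {:V}) x = 0.
Proof.
have kerS i : (lker (lpow f i) <= lker (lpow f i.+1))%VS.
  by apply/subvP=> y; rewrite !memv_ker => /eqP e; rewrite lpowSE e linear0.
have ker_stop i : (lker (lpow f i.+1) <= lker (lpow f i))%VS ->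
    (lker (lpow f i.+2) <= lker (lpow f i.+1))%VS.
  move=> /subvP s; apply/subvP=> y; rewrite !memv_ker lpowSrE => e.
  by have := s (f y); rewrite !memv_ker => /(_ e); rewrite -lpowSrE.
have ker_dim i : (i <= \dim (lker (lpow f i)))%N \/
    (lker (lpow f i.+1) <= lker (lpow f i))%VS.
  elim: i => [|i [IH|IH]]; first by left.
    case: (boolP (lker (lpow f i.+1) <= lker (lpow f i))%VS) => [s|ns].
      by right; apply: ker_stop.
    left; apply: leq_ltn_trans IH _.
    by rewrite (ltn_leqif (dimv_leqif_sup (kerS i))).
  by right; apply: ker_stop.
set n := \dim {:V}.
have stab : (lker (lpow f n.+1) <= lker (lpow f n))%VS.
  case: (ker_dim n) => // le_n.
  have: (lker (lpow f n) == fullv) by rewrite eqEdim subvf.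
  by move=> /eqP ->; apply: subvf.
elim: k x => [|k IH] x; first by rewrite lpow0E => ->; rewrite linear0.
rewrite lpowSrE => /IH; rewrite -lpowSrE => e.
by apply/eqP; rewrite -memv_ker; apply: (subvP stab); rewrite memv_ker e.
Qed.

End Powers.

Lemma linear_linfunE (F : fieldType) (U V : vectType F) (g : U -> V) :
  linear g -> linfun g =1 g.
Proof.
move=> gl; pose G := HB.pack_for {linear U -> V} g (GRing.isLinear.Build F U V _ g gl).
exact: (lfunE G).
Qed.

Section Trace.
Variables (F : fieldType) (V : vectType F).
Implicit Types (f g p : 'End(V)) (x : V).

Let b := vbasis {:V}.

(** The trace on a subspace is always written [ltrace (f \o p)] with [p] an idempotent onto it, so
    that no restricted endomorphism is formed. *)
Definition ltrace f : F := \sum_i coord b i (f b`_i).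

Fact ltrace_is_scalar : scalar ltrace.
Proof.
move=> a f g; rewrite /ltrace /= mulr_sumr -big_split /=; apply: eq_bigr => i _.
by rewrite add_lfunE scale_lfunE linearP.
Qed.
HB.instance Definition _ := GRing.isSemilinear.Build F 'End(V) F _ ltrace
  (GRing.semilinear_linear ltrace_is_scalar).

End Trace.

Lemma ltraceC (F : fieldType) (U V : vectType F) (f : 'Hom(V, U)) (g : 'Hom(U, V)) :
  ltrace (f \o g)%VF = ltrace (g \o f)%VF.
Proof.
have E (U' V' : vectType F) (f' : 'Hom(V', U')) (g' : 'Hom(U', V')) :
    ltrace (f' \o g')%VF = \sum_(i < \dim {:U'}) \sum_(j < \dim {:V'})
      coord (vbasis {:V'}) j (g' (vbasis {:U'})`_i) *
      coord (vbasis {:U'}) i (f' (vbasis {:V'})`_j).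
  apply: eq_bigr => i _.
  rewrite comp_lfunE {1}(coord_vbasis (memvf (g' _))) !linear_sum.
  by apply: eq_bigr => j _; rewrite !linearZ.
rewrite !E exchange_big /=; apply: eq_bigr => i _; apply: eq_bigr => j _.
by rewrite mulrC.
Qed.

Section TraceTheory.
Variables (F : fieldType) (V : vectType F).
Implicit Types (f g p : 'End(V)) (x : V).

Lemma ltrace_rank1 f (phi : 'Hom(V, F^o)) e :
  (forall x, f x = phi x *: e) -> ltrace f = phi e.
Proof.
move=> fE; rewrite [in RHS](coord_vbasis (memvf e)) linear_sum; apply: eq_bigr => i _.
by rewrite fE !linearZ /= mulrC.
Qed.

(** On a basis [c] of the image, [p] is the sum of the rank one maps [x |-> coord c i (p x) *: c_i],
    each of trace 1. *)
Lemma ltrace_idem p : (forall x, p (p x) = p x) -> ltrace p = (\dim (limg p))%:R.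
Proof.
move=> pp; pose c := vbasis (limg p).
have cP (i : 'I_(\dim (limg p))) : p c`_i = c`_i.
  have: c`_i \in limg p by apply: vbasis_mem; rewrite mem_nth ?size_tuple.
  by case/memv_imgP => y _ ->; rewrite pp.
pose R i : 'End(V) := linfun (fun x => coord c i (p x) *: c`_i).
have RE i x : R i x = coord c i (p x) *: c`_i.
  by apply: linear_linfunE => a y z; rewrite !linearP /= scalerDl scalerA.
have pE : p = \sum_i R i.
  apply/lfunP=> x; rewrite sum_lfunE.
  rewrite {1}(coord_vbasis (memv_img p (memvf x))).
  by apply: eq_bigr => i _; rewrite RE.
rewrite [in LHS]pE linear_sum /= (eq_bigr (fun=> 1)) ?sumr_const ?card_ord // => i _.
pose phi : 'Hom(V, F^o) := (linfun (coord c i : V -> F^o) \o p)%VF.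
have phiE x : phi x = coord c i (p x) by rewrite comp_lfunE lfunE.
rewrite (@ltrace_rank1 _ phi c`_i) => [|x]; last by rewrite RE phiE.
by rewrite phiE cP coord_free ?eqxx // (basis_free (vbasisP _)).
Qed.

(* The trace of [f] on a subspace [U] equals its trace on any [U'] with
   [f @: U <= U' <= U]; apply this along the chain [limg (lpow f j \o p)]. *)
Lemma ltrace_nilp f p k : (forall x, p (p x) = p x) ->
    (forall x, f (p x) = p (f x)) -> (forall x, lpow f k (p x) = 0) ->
  ltrace (f \o p)%VF = 0.
Proof.
move=> pp fp nil.
pose Q j := projv (limg (lpow f j \o p)%VF).
have QI j x : Q j (lpow f j (p x)) = lpow f j (p x).
  by apply: projv_id; rewrite -comp_lfunE memv_img ?memvf.
have img j y : exists x, Q j y = lpow f j (p x).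
  have /memv_imgP[x _ e] := memv_proj (limg (lpow f j \o p)%VF) y.
  by exists x; rewrite -comp_lfunE.
have step j : ltrace (f \o Q j)%VF = ltrace (f \o Q j.+1)%VF.
  have -> : (f \o Q j = Q j.+1 \o (f \o Q j))%VF.
    apply/lfunP=> y; rewrite !comp_lfunE; have [x ->] := img j y.
    by rewrite -lpowSE QI.
  rewrite (ltraceC (Q j.+1)) -comp_lfunA; congr (ltrace (_ \o _)%VF).
  apply/lfunP=> y; rewrite !comp_lfunE; have [x ->] := img j.+1 y.
  by rewrite lpowSrE fp QI.
have -> : (f \o p = Q 0%N \o (f \o p))%VF.
  apply/lfunP=> x; rewrite !comp_lfunE fp -(pp (f x)) -[in RHS](lpow0E f (p _)).
  by rewrite QI lpow0E.
rewrite ltraceC -comp_lfunA.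
have -> : (p \o Q 0%N = Q 0%N)%VF.
  apply/lfunP=> y; rewrite !comp_lfunE; have [x ->] := img 0%N y.
  by rewrite lpow0E pp.
have -> : ltrace (f \o Q 0%N)%VF = ltrace (f \o Q k)%VF.
  by elim: (k) => // j ->; apply: step.
have -> : (f \o Q k)%VF = 0.
  apply/lfunP=> y; rewrite comp_lfunE zero_lfunE; have [x ->] := img k y.
  by rewrite nil linear0.
by rewrite linear0.
Qed.

End TraceTheory.

Section Split.
Variables (F : fieldType) (V : vectType F).
Implicit Types (f g p : 'End(V)) (x : V).

(* [e] is the projection onto [lker (lpow f n)] along [limg (lpow f n)]. *)
Lemma fitting f (n := \dim {:V}) : exists e : 'End(V),
  [/\ forall x, e (e x) = e x, forall x, lpow f n (e x) = 0,
      forall k x, lpow f k x = 0 -> e x = x &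
      forall g, (forall x, lpow f n x = 0 -> lpow f n (g x) = 0) ->
        (forall x, g (lpow f n x) \in limg (lpow f n)) ->
        forall x, g (e x) = e (g x)].
Proof.
set A := lker (lpow f n); set B := limg (lpow f n).
have AB0 : (A :&: B = 0)%VS.
  apply/eqP; rewrite -subv0; apply/subvP=> x; rewrite memv_cap memv0 memv_ker.
  case/andP=> /eqP fx /memv_imgP[y _ xE].
  have: lpow f (n + n) y = 0 by rewrite lpowDE -xE fx.
  by rewrite xE => /lpow_eq0_dim ->.
have ABf : (A + B = fullv)%VS.
  apply/eqP; rewrite eqEdim subvf /= (dimv_disjoint_sum AB0) -/n.
  by have := limg_ker_dim (lpow f n) fullv; rewrite capfv => ->.
exists (daddv_pi A B).
have dec x : x = daddv_pi A B x + daddv_pi B A x.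
  by rewrite (daddv_pi_add AB0) // ABf memvf.
have BA0 : (B :&: A = 0)%VS by rewrite capvC.
have piB x : x \in B -> daddv_pi A B x = 0.
  by move=> xB; apply: (addIr (daddv_pi B A x)); rewrite -dec add0r daddv_pi_id.
split=> [x|x|k x|g gA gB x].
- by rewrite daddv_pi_id ?memv_pi.
- by apply/eqP; rewrite -memv_ker memv_pi.
- move=> /lpow_eq0_dim e; apply: daddv_pi_id => //.
  by rewrite memv_ker -/n e.
rewrite {2}(dec x) !linearD /= [X in _ = _ + X]piB ?addr0.
  rewrite [RHS]daddv_pi_id // memv_ker; apply/eqP/gA/eqP.
  by rewrite -memv_ker memv_pi.
by have /memv_imgP[y _ ->] := memv_pi B A x.
Qed.

End Split.

Section Eigenvectors.
Import VectorInternalTheory.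

Lemma eigenvector_closed (F : closedFieldType) (V : vectType F) (f : 'End(V)) :
  (0 < \dim {:V})%N -> exists a x, x != 0 /\ f x = a *: x.
Proof.
rewrite dimvf => n_gt0.
have /closed_rootP[a] : size (char_poly (f2mx f)) != 1%N.
  by rewrite size_char_poly; case: (dim V) n_gt0.
rewrite -eigenvalue_root_char => /eigenvalueP[v vf v0].
exists a, (r2v v); split; first by apply: contraNneq v0 => e; rewrite -(r2vK v) e linear0.
by rewrite unlock /= r2vK vf linearZ.
Qed.

Lemma eigenvector_in (F : closedFieldType) (V : vectType F) (f : 'End(V))
    (U : {vspace V}) : U != 0%VS -> (forall x, x \in U -> f x \in U) ->
  exists a x, [/\ x != 0, x \in U & f x = a *: x].
Proof.
move=> U0 fU; pose g : 'End(subvs_of U) := (linfun (vsproj U) \o f \o linfun vsval)%VF.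
have gE u : vsval (g u) = f (vsval u).
  by rewrite !comp_lfunE !lfunE /= vsprojK // fU // subvsP.
have [|a [u [u0 gu]]] := eigenvector_closed g.
  by rewrite dimvf /dim /= lt0n dimv_eq0.
exists a, (vsval u); split; last by rewrite -gE gu linearZ.
  by apply: contraNneq u0 => e; apply/eqP/subvs_inj; rewrite e linear0.
exact: subvsP.
Qed.


End Eigenvectors.

(** * Lie brackets and Engel's theorem *)

(** Lets an element of the Fitting image be rewritten with any surplus of factors [f], which
    [br_limg_shf] then consumes. *)
Lemma limg_lpow_stable (F : fieldType) (V : vectType F) (f : 'End(V)) k
    (n := \dim {:V}) : limg (lpow f (n + k)) = limg (lpow f n).
Proof.
have sub : (limg (lpow f (n + k)) <= limg (lpow f n))%VS.
  apply/subvP=> _ /memv_imgP[x _ ->]; rewrite lpowDE.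
  by rewrite memv_img ?memvf.
apply/eqP; rewrite eqEdim sub /=.
have kerE : lker (lpow f (n + k)) = lker (lpow f n).
  apply/vspaceP=> x; rewrite !memv_ker.
  by apply/eqP/eqP => [/lpow_eq0_dim|/(lpow_eq0_leq (leq_addr k n))].
have := limg_ker_dim (lpow f n) fullv.
by rewrite -(limg_ker_dim (lpow f (n + k)) fullv) kerE => /addnI ->.
Qed.

Lemma sum_supp (I : eqType) (V : nmodType) (r r' : seq I) (G : I -> V) :
    uniq r -> uniq r' -> {subset r <= r'} -> (forall i, i \notin r -> G i = 0) ->
  \sum_(i <- r') G i = \sum_(i <- r) G i.
Proof.
move=> ur ur' sub G0; rewrite (bigID (mem r)) /= [X in _ + X]big1 ?addr0 //.
rewrite -big_filter; apply/perm_big/uniq_perm; rewrite ?filter_uniq // => i.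
by rewrite mem_filter /=; case: (boolP (i \in r)) => // /sub ->.
Qed.

Lemma sum_delta (I : eqType) (V : nmodType) (r : seq I) i (G : I -> V) :
    uniq r -> (i \notin r -> G i = 0) -> (forall j, j != i -> G j = 0) ->
  \sum_(j <- r) G j = G i.
Proof.
move=> ur Gi Gj; have [ri|nri] := boolP (i \in r).
  by rewrite (bigD1_seq i) //= big1 ?addr0.
rewrite Gi // big1_seq // => j /andP[_ rj]; apply: Gj.
by apply: contraNneq nri => <-.
Qed.

Section LieAlgebra.
Variables (F : fieldType) (L : vectType F) (br : L -> L -> L).
Hypothesis Hlie : lie_bracket br.
Implicit Types (x y z t : L) (a b : F).

Lemma brPl a x y z : br (a *: x + y) z = a *: br x z + br y z.
Proof. by case: Hlie. Qed.

Lemma brPr a x y z : br z (a *: x + y) = a *: br z x + br z y.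
Proof. by case: Hlie. Qed.

Lemma brxx x : br x x = 0.
Proof. by case: Hlie. Qed.

Lemma adE x y : ad br x y = br x y.
Proof. by apply: linear_linfunE => a u v; apply: brPr. Qed.

Lemma brDr x y z : br x (y + z) = br x y + br x z.
Proof. by rewrite -!adE linearD. Qed.
Lemma brNr x y : br x (- y) = - br x y.
Proof. by rewrite -!adE linearN. Qed.
Lemma brBr x y z : br x (y - z) = br x y - br x z.
Proof. by rewrite brDr brNr. Qed.
Lemma br0r x : br x 0 = 0.
Proof. by rewrite -adE linear0. Qed.
Lemma brZr a x y : br x (a *: y) = a *: br x y.
Proof. by rewrite -!adE linearZ. Qed.
Lemma br_sumr (I : Type) (r : seq I) (P : pred I) (G : I -> L) x :
  br x (\sum_(i <- r | P i) G i) = \sum_(i <- r | P i) br x (G i).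
Proof. by rewrite -adE linear_sum; apply: eq_bigr => i _; apply: adE. Qed.

Lemma brDl x y z : br (x + y) z = br x z + br y z.
Proof. by rewrite -{1}[x]scale1r brPl scale1r. Qed.

Lemma brC x y : br x y = - br y x.
Proof.
apply/eqP; rewrite -addr_eq0; have /eqP := brxx (x + y).
by rewrite brDl !brDr !brxx addr0 add0r.
Qed.

Lemma br0l x : br 0 x = 0.
Proof. by rewrite brC br0r oppr0. Qed.
Lemma brNl x y : br (- x) y = - br x y.
Proof. by rewrite brC brNr -brC. Qed.
Lemma brZl a x y : br (a *: x) y = a *: br x y.
Proof. by rewrite brC brZr -scalerN -brC. Qed.
Lemma br_suml (I : Type) (r : seq I) (P : pred I) (G : I -> L) x :
  br (\sum_(i <- r | P i) G i) x = \sum_(i <- r | P i) br (G i) x.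
Proof. by rewrite brC br_sumr -sumrN; apply: eq_bigr => i _; rewrite -brC. Qed.

Lemma jacobi x y z : br x (br y z) = br (br x y) z + br y (br x z).
Proof.
have : br x (br y z) + br y (br z x) + br z (br x y) = 0 by case: Hlie.
move=> /eqP; rewrite -addrA addr_eq0 => /eqP ->.
by rewrite opprD addrC [br z (br x y)]brC opprK [br z x]brC brNr opprK.
Qed.

Lemma ad_br x y : ad br (br x y) = ((ad br x \o ad br y) - (ad br y \o ad br x))%VF.
Proof.
apply/lfunP=> z; rewrite add_lfunE opp_lfunE !comp_lfunE !adE jacobi.
by rewrite addrK.
Qed.

Definition shf t a : 'End(L) := ad br t - a *: \1%VF.

Lemma shfE t a x : shf t a x = br t x - a *: x.
Proof. by rewrite add_lfunE opp_lfunE scale_lfunE id_lfunE adE. Qed.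

Lemma shf_br t a b x y :
  shf t (a + b) (br x y) = br (shf t a x) y + br x (shf t b y).
Proof.
rewrite !shfE jacobi brDl brNl brZl brBr brZr scalerDl opprD.
by rewrite [RHS]addrACA.
Qed.

(** By the Leibniz rule [shf_br], each application yields two brackets, each with one exponent
    lowered; when an exponent reaches 0 the bracket is zero. Hence generalized weights add under the
    bracket. *)
Lemma shf_pow_br t a b x y k l : lpow (shf t a) k x = 0 -> lpow (shf t b) l y = 0 ->
  lpow (shf t (a + b)) (k + l) (br x y) = 0.
Proof.
move: {-1}(k + l)%N (leqnn (k + l)) => s.
elim: s k l x y => [|s IH] [|k] [|l] x y // skl.
1-4: by rewrite ?lpow0E => ex ey; rewrite ?ex ?ey ?br0l ?br0r ?linear0.
move=> xk yl; rewrite lpowSrE shf_br linearD /=.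
rewrite (IH k l.+1) -?lpowSrE // (IH k.+1 l) -?lpowSrE ?add0r //.
by rewrite addSnnS.
Qed.

(** Induction on [k] reduces to a true [a]-eigenvector, on which [shf t b] is the nonzero scalar
    [a - b]. *)
Lemma shf_pow_disjoint t a b x k l :
  a != b -> lpow (shf t a) k x = 0 -> lpow (shf t b) l x = 0 -> x = 0.
Proof.
move=> ab; elim: k x => [|k IH] x; first by rewrite lpow0E.
rewrite lpowSrE => xk xl.
have cm z : shf t b (shf t a z) = shf t a (shf t b z).
  rewrite !shfE !brBr !brZr !scalerBr !scalerA mulrC !opprB.
  by rewrite addrACA [RHS]addrACA [- (a *: _) + _]addrC.
have /eqP : shf t a x = 0 by apply: IH; rewrite ?(lpow_comm cm) ?xl ?linear0.
rewrite shfE subr_eq0 => /eqP tx.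
have: lpow (shf t b) l x = (a - b) ^+ l *: x.
  elim: (l) => [|j IHj]; first by rewrite lpow0E scale1r.
  by rewrite lpowSE IHj shfE brZr tx !scalerA -scalerBl exprSr mulrBr [b * _]mulrC.
rewrite xl => /esym/eqP; rewrite scaler_eq0 expf_eq0 subr_eq0 (negPf ab) andbF /=.
by move/eqP.
Qed.

Lemma bracket_space_mem (A B : {vspace L}) x y :
  x \in A -> y \in B -> br x y \in bracket_space br A B.
Proof.
move=> /coord_vbasis -> /coord_vbasis ->; rewrite br_suml rpred_sum // => i _.
rewrite br_sumr rpred_sum // => j _; rewrite brZl brZr !rpredZ //.
by apply: memv_span; apply: allpairs_f; rewrite mem_nth ?size_tuple.
Qed.

(* Engel's theorem for a nilpotent Lie algebra [h] acting on [V / U] by nilpotent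
   operators: the lower central series is adjoined to the annihilator of a vector
   one element at a time. *)
Lemma engel (h : {vspace L}) (rho : L -> 'End(L)) (V U : L -> Prop) :
    nilpotent_subalgebra br h -> linear rho ->
    (forall s r x, s \in h -> r \in h ->
       rho s (rho r x) = rho r (rho s x) + rho (br s r) x) ->
    (forall s x, s \in h -> V x -> V (rho s x)) ->
    (forall s x, s \in h -> U x -> U (rho s x)) ->
    submod_closed (fun x => `[< U x >]) ->
    (forall s x, s \in h -> V x -> exists k, U (lpow (rho s) k x)) ->
  (exists2 x, V x & ~ U x) ->
  exists2 x, V x /\ ~ U x & forall s, s \in h -> U (rho s x).
Proof.
move=> [hsub [n hn]] rholin rhobr VS US [U0 UD] nil [x0 Vx0 Ux0].
have UP u v c : U u -> U v -> U (c *: u + v).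
  move=> /asboolP uU /asboolP vU; apply/asboolP; exact: UD.
have UA u v : U u -> U v -> U (u + v) by rewrite -{2}[u]scale1r; apply: UP.
have lcs_h k : (lcs br h k <= h)%VS.
  elim: k => [|k IH] /=; first exact: subvv.
  apply/span_subvP=> _ /allpairsP[[u v] /= [/vbasis_mem uh /vbasis_mem vk ->]].
  by apply: hsub => //; apply: (subvP IH).
pose good (A : {vspace L}) := exists2 x, V x /\ ~ U x & forall s, s \in A -> U (rho s x).
have add1 (A : {vspace L}) s : s \in h -> (A <= h)%VS ->
    (forall u, u \in A -> br u s \in A) -> good A -> good (A + <[s]>)%VS.
  move=> sh /subvP Ah As [x [Vx Ux] xA].
  have Vi i : V (lpow (rho s) i x).
    by elim: i => [|i IH]; rewrite ?lpow0E // lpowSE; apply: VS.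
  (* Commuting [u] past [rho s] costs the term [rho [s, u]], and [[s, u]] is again in [A]; so [A]
     annihilates every iterate modulo [U]. *)
  have Ai i u : u \in A -> U (rho u (lpow (rho s) i x)).
    elim: i u => [|i IH] u uA; first by rewrite lpow0E; apply: xA.
    rewrite lpowSE rhobr ?(Ah _ uA) //; apply: UA; last exact: IH (As _ uA).
    by apply: US => //; apply: IH.
  have [k0 Uk0] := nil s x sh Vx.
  have exk : exists k, `[< U (lpow (rho s) k x) >] by exists k0; apply/asboolP.
  (* The new vector is the last iterate outside [U]. The minimal exponent cannot be 0, since [x]
     itself is outside [U]. *)
  case: (ex_minnP exk) => [[|k]] /asboolP Uk kmin.
    by case: Ux; rewrite lpow0E in Uk.
  exists (lpow (rho s) k x).
    by split=> // /asboolP /kmin; rewrite ltnn.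
  move=> _ /memv_addP[u uA [_ /vlineP[c ->] ->]].
  rewrite addrC rholin add_lfunE scale_lfunE; apply: UP; last exact: Ai.
  by rewrite -lpowSE.
(* Brackets of [h] with [lcs br h k'] fall into the next term [A], so whatever vectors [X] have been
   adjoined, bracketing [A + <<X>>] with a further basis vector lands in [A], as [add1] requires. *)
have lcsP k : good (lcs br h k) -> forall k', k = k'.+1 -> good (lcs br h k').
  move=> gk k' kE; rewrite kE /= in gk; set A := bracket_space br h (lcs br h k') in gk.
  have hA u v : u \in h -> v \in lcs br h k' -> br u v \in A by exact: bracket_space_mem.
  have Ah : (A <= h)%VS by exact: (lcs_h k'.+1).
  have Xg (X : seq L) : {subset X <= lcs br h k'} -> good (A + <<X>>)%VS /\ (A + <<X>> <= h)%VS.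
    elim: X => [|v X IH] Xs; first by rewrite span_nil addv0.
    have [gX Xh] : good (A + <<X>>)%VS /\ (A + <<X>> <= h)%VS.
      by apply: IH => u uX; apply: Xs; rewrite inE uX orbT.
    have vk : v \in lcs br h k' by apply: Xs; rewrite mem_head.
    have vh : v \in h by apply: (subvP (lcs_h k')).
    rewrite span_cons [(<[v]> + _)%VS]addvC addvA; split.
      apply: add1 => // u uX; apply: (subvP (addvSl _ _)); apply: hA => //.
      exact: (subvP Xh).
    by rewrite subv_add Xh -memvE.
  have [[x Vx xA] _] := Xg _ (@vbasis_mem _ _ ^~ (lcs br h k')).
  exists x => // s sk; apply: xA; apply: (subvP (addvSr _ _)).
  by rewrite (span_basis (vbasisP _)).
have good_n : good (lcs br h n).
  exists x0 => // s; rewrite hn memv0 => /eqP ->.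
  have -> : rho 0 = 0 by rewrite -(addrN 0) -[in RHS](addrN (rho 0)) addrC -{1}scaleN1r rholin scaleN1r addrC.
  by rewrite zero_lfunE; apply/asboolP.
suff: good (lcs br h 0) by [].
by elim: {hn}n good_n => // n IH /lcsP/(_ _ erefl).
Qed.

End LieAlgebra.

(** * Generalized weight spaces *)

Section WeightDecomposition.
Variables (F : closedFieldType) (L : vectType F) (br : L -> L -> L).
Hypotheses (charF0 : [pchar F] =i pred0) (Hlie : lie_bracket br).
Variable h : {vspace L}.
Hypothesis Hnil : nilpotent_subalgebra br h.
Local Notation H := (subvs_of h).
Local Notation wt := 'Hom(subvs_of h, F^o).
Implicit Types (t s : H) (l mu : wt) (x y : L) (p : 'End(L)).

Definition gen l x := forall t : H, exists k, lpow (shf br (vsval t) (l t)) k x = 0.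

(** [q l] projects onto the generalized weight space of [l] inside the image of [p]. It is defined
    for every functional, with value 0 off [ws], so that [l + mu] needs no membership test; keeping
    [p] general allows induction on its rank. *)
Record wdec p (ws : seq wt) (q : wt -> 'End(L)) : Prop := Wdec {
  wdec_uniq : uniq ws;
  wdec_out : forall l, l \notin ws -> q l = 0;
  wdec_sum : forall x, \sum_(l <- ws) q l x = p x;
  wdec_orth : forall l mu x, q l (q mu x) = if l == mu then q mu x else 0;
  wdec_comm : forall l t x, br (vsval t) (q l x) = q l (br (vsval t) x);
  wdec_gen : forall l x, gen l (q l x) }.

Lemma wdec_sum_orth p ws q (W : wdec p ws q) l x :
  \sum_(mu <- ws) q mu (q l x) = q l x.
Proof.
rewrite (sum_delta (i := l)) ?(wdec_uniq W) //.
- by rewrite (wdec_orth W) eqxx.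
- by move=> /(wdec_out W) ->; rewrite zero_lfunE.
- by move=> mu /negPf e; rewrite (wdec_orth W) e.
Qed.

Lemma wdec_pl p ws q (W : wdec p ws q) l x : p (q l x) = q l x.
Proof. by rewrite -(wdec_sum W) (wdec_sum_orth W). Qed.

Lemma wdec_pr p ws q (W : wdec p ws q) l x : q l (p x) = q l x.
Proof.
rewrite -(wdec_sum W) linear_sum /=.
rewrite (sum_delta (i := l)) ?(wdec_uniq W) //.
- by rewrite (wdec_orth W) eqxx.
- by move=> /(wdec_out W) ->; rewrite zero_lfunE.
- by move=> mu /negPf e; rewrite (wdec_orth W) eq_sym e.
Qed.

Lemma wdec_add p0 p1 ws0 ws1 q0 q1 :
    (forall x, p0 (p1 x) = 0) -> (forall x, p1 (p0 x) = 0) ->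
    wdec p0 ws0 q0 -> wdec p1 ws1 q1 ->
  wdec (p0 + p1) (undup (ws0 ++ ws1)) (fun l => q0 l + q1 l).
Proof.
move=> p01 p10 W0 W1; split.
- exact: undup_uniq.
- move=> l; rewrite mem_undup mem_cat negb_or => /andP[l0 l1].
  by rewrite (wdec_out W0) // (wdec_out W1) // addr0.
- move=> x; under eq_bigr => l _ do rewrite add_lfunE.
  rewrite big_split /= add_lfunE -(wdec_sum W0) -(wdec_sum W1).
  congr (_ + _); apply: sum_supp; rewrite ?undup_uniq ?(wdec_uniq W0) ?(wdec_uniq W1) //.
  + by move=> l; rewrite mem_undup mem_cat => ->.
  + by move=> l /(wdec_out W0) ->; rewrite zero_lfunE.
  + by move=> l; rewrite mem_undup mem_cat => ->; rewrite orbT.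
  + by move=> l /(wdec_out W1) ->; rewrite zero_lfunE.
- move=> l mu x; rewrite !add_lfunE !linearD /= !(wdec_orth W0) !(wdec_orth W1).
  have -> : q0 l (q1 mu x) = 0.
    by rewrite -(wdec_pr W0) -(wdec_pl W1) p01 linear0.
  have -> : q1 l (q0 mu x) = 0.
    by rewrite -(wdec_pr W1) -(wdec_pl W0) p10 linear0.
  by case: eqP => _; rewrite ?addr0 ?add0r.
- by move=> l t x; rewrite !add_lfunE brDr // (wdec_comm W0) (wdec_comm W1).
move=> l x t; have [k0 e0] := wdec_gen W0 l x t; have [k1 e1] := wdec_gen W1 l x t.
exists (k0 + k1)%N; rewrite add_lfunE linearD /=.
rewrite (lpow_eq0_leq (leq_addr _ _) e0) (lpow_eq0_leq (leq_addl _ _) e1).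
exact: addr0.
Qed.

(** After discarding zero projections, [ws] lists exactly the weights that occur. *)
Lemma wdec_filter p ws q : wdec p ws q -> wdec p [seq l <- ws | q l != 0] q.
Proof.
move=> W; split; try by case: W.
- by rewrite filter_uniq ?(wdec_uniq W).
- move=> l; rewrite mem_filter negb_and negbK => /orP[/eqP //|].
  exact: (wdec_out W).
move=> x; rewrite -(wdec_sum W); symmetry; apply: sum_supp.
- by rewrite filter_uniq ?(wdec_uniq W).
- exact: (wdec_uniq W).
- by move=> l; rewrite mem_filter => /andP[].
move=> l; rewrite mem_filter negb_and negbK => /orP[/eqP|/(wdec_out W)] ->;
  exact: zero_lfunE.
Qed.

Lemma br_nilp_sub t s : exists k, lpow (shf br (vsval t) 0) k (vsval s) = 0.
Proof.
have [hsub [n hn]] := Hnil; exists n; apply/eqP; rewrite -memv0 -hn.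
elim: (n) => [|k IH]; first by rewrite lpow0E subvsP.
by rewrite lpowSE shfE // scale0r subr0 bracket_space_mem // subvsP.
Qed.

(** Moving [s] past one factor [shf t a] leaves the error [br (br t s) z], and [br t s] is killed by
    one power fewer. The [n] surplus factors pay for these errors: induction on [n], then on [j]. *)
Lemma br_limg_shf (t s : L) a n x : lpow (shf br t 0) n s = 0 ->
  forall j, br s (lpow (shf br t a) (j + n) x) \in limg (lpow (shf br t a) j).
Proof.
elim: n s => [|n IHn] s; first by rewrite lpow0E => -> j; rewrite br0l // mem0v.
move=> sn; elim=> [|j IHj].
  by apply/memv_imgP; exists (br s (lpow (shf br t a) (0 + n.+1) x)); rewrite ?memvf ?lpow0E.
rewrite addnS lpowSE; set z := lpow _ _ _.
have -> : br s (shf br t a z) = shf br t a (br s z) - br (shf br t 0 s) z.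
  by have := shf_br Hlie t 0 a s z; rewrite add0r => ->; rewrite addrC addKr.
rewrite rpredB //; last by apply: IHn; rewrite -lpowSrE.
rewrite {}/z addSnnS; have /memv_imgP[y _ ->] := IHj.
by rewrite -lpowSE memv_img ?memvf.
Qed.

(** The projection commutes with [h] because [h] preserves both summands: the kernel since elements
    of [h] have generalized eigenvalue 0 under [ad t], the image by [br_limg_shf]. *)
Lemma fitting_h t a : exists e : 'End(L),
  [/\ forall x, e (e x) = e x,
      forall x, lpow (shf br (vsval t) a) (\dim {:L}) (e x) = 0,
      forall x, br (vsval t) x = a *: x -> e x = x,
      forall s x, br (vsval s) (e x) = e (br (vsval s) x) &
      forall p, (forall s x, br (vsval s) (p x) = p (br (vsval s) x)) ->
        forall x, p (e x) = e (p x)].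
Proof.
have [e [ee eN eK ec]] := fitting (shf br (vsval t) a).
exists e; split=> // [x tx|s x|p pc x].
- by apply: (eK 1%N); rewrite lpowSE lpow0E shfE // tx subrr.
- rewrite -!(adE Hlie); apply: ec => {}x; rewrite (adE Hlie).
    have [k sk] := br_nilp_sub t s; move=> xn.
    by have := shf_pow_br Hlie sk xn; rewrite add0r => /lpow_eq0_dim.
  have [k sk] := br_nilp_sub t s.
  have: lpow (shf br (vsval t) a) (\dim {:L}) x \in
        limg (lpow (shf br (vsval t) a) (\dim {:L} + k)).
    by rewrite limg_lpow_stable memv_img ?memvf.
  by case/memv_imgP=> y _ ->; apply: br_limg_shf.
have cN k y : lpow (shf br (vsval t) a) k (p y) = p (lpow (shf br (vsval t) a) k y).
  by apply: lpow_comm => z; rewrite !shfE // pc linearB /= lfunZ.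
apply: ec => y; first by rewrite cN => ->; rewrite linear0.
by rewrite -cN memv_img ?memvf.
Qed.

Lemma natf_eq0 n : (n%:R == 0 :> F) = (n == 0%N).
Proof. by move/pcharf0P: charF0. Qed.

Lemma natf_inj n k : n%:R = k%:R :> F -> n = k.
Proof.
wlog le_nk : n k / (n <= k)%N => [Hw e|/esym/eqP].
  by case: (leqP n k) => [|/ltnW] le; [|symmetry]; apply: Hw.
rewrite -subr_eq0 -natrB // natf_eq0 subn_eq0 => le_kn.
by apply/eqP; rewrite eqn_leq le_nk.
Qed.

Lemma limg_idemE p x : (forall x, p (p x) = p x) -> (x \in limg p) = (p x == x).
Proof.
move=> pp; apply/idP/eqP => [/memv_imgP[y _ ->]|<-]; first exact: pp.
by rewrite memv_img ?memvf.
Qed.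

(** Induction on the rank of [p]. If some [ad t] has two generalized eigenvalues on the image, a
    Fitting projection of [t] splits it; otherwise there is a single weight. *)
Lemma weight_decomposition p : (forall x, p (p x) = p x) ->
    (forall t x, br (vsval t) (p x) = p (br (vsval t) x)) ->
  exists ws q, wdec p ws q.
Proof.
have [d] := ubnP (\dim (limg p)); elim: d p => // d IH p /ltnSE pd pp pc.
have [/eqP p0|p_neq0] := eqVneq (limg p) 0%VS.
  exists [::], (fun=> 0); split=> // [x|l mu x|l t x|l x t].
  - by rewrite big_nil; apply/esym/eqP; rewrite -memv0 -(eqP p0) memv_img ?memvf.
  - by rewrite !zero_lfunE if_same.
  - by rewrite !zero_lfunE br0r.
  - by exists 0%N; rewrite zero_lfunE linear0.
case: (pselect (forall t, exists a, forall x,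
    exists k, lpow (shf br (vsval t) a) k (p x) = 0)) => [single|].
  (* The unique eigenvalue of [t] is its trace divided by the dimension. This makes it linear in [t]
     without Lie's theorem, and uses characteristic 0 to invert [D]. *)
  pose D : F := (\dim (limg p))%:R.
  have D0 : D != 0 by rewrite natf_eq0 dimv_eq0.
  pose g (t : H) : F^o := ltrace (ad br (vsval t) \o p)%VF / D.
  pose l0 : wt := linfun g.
  have l0E t : l0 t = g t.
    apply: linear_linfunE => a u v; rewrite /g.
    have -> : (ad br (vsval (a *: u + v)) \o p =
        a *: (ad br (vsval u) \o p) + (ad br (vsval v) \o p))%VF.
      apply/lfunP=> x; rewrite add_lfunE scale_lfunE !comp_lfunE !adE //.
      by rewrite linearP brPl.
    by rewrite linearP /= mulrDl -mulrA.
  have nil t x : exists k, lpow (shf br (vsval t) (l0 t)) k (p x) = 0.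
    have [a nila] := single t; rewrite l0E.
    suff -> : g t = a by [].
    have: ltrace (shf br (vsval t) a \o p)%VF = 0.
      apply: (@ltrace_nilp _ _ _ _ (\dim {:L})) => // y.
        by rewrite !shfE // pc linearB /= lfunZ.
      by have [k /lpow_eq0_dim] := nila y.
    rewrite comp_lfunDl comp_lfunNl -comp_lfunZl comp_lfun1l linearB linearZ /=.
    rewrite (ltrace_idem pp) => /eqP; rewrite subr_eq0 => /eqP E.
    by rewrite /g E mulfK.
  exists [:: l0], (fun l => if l == l0 then p else 0); split=> //.
  - by move=> l; rewrite inE => /negPf ->.
  - by move=> x; rewrite big_seq1 eqxx.
  - move=> l mu x; case: (eqVneq mu l0) => [->|nmu].
      by case: eqP => [|_]; rewrite ?pp // zero_lfunE.
    by rewrite zero_lfunE linear0 if_same.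
  - by move=> l t x; case: eqP => _; rewrite ?pc // !zero_lfunE br0r.
  - move=> l x t; case: eqP => [->|_]; first exact: nil.
    by exists 0%N; rewrite zero_lfunE linear0.
move=> /existsNP[t /forallNP nsingle].
have tp x : x \in limg p -> ad br (vsval t) x \in limg p.
  by rewrite !limg_idemE // adE // -pc => /eqP ->.
have [a [y [y0 yp ty]]] := eigenvector_in p_neq0 tp.
have [e [ee eN eE ec ecp]] := fitting_h t a.
have py : p y = y by apply/eqP; rewrite -limg_idemE.
(* Both pieces have smaller rank: [p0] is not all of [p] because [a] is not the only eigenvalue, and
   [p1] is not because it kills [y]. *)
have {}ecp x : p (e x) = e (p x) by apply: ecp.
have ey : e y = y by apply: eE; rewrite -ty adE.
pose p0 := (p \o e)%VF; pose p1 : 'End(L) := p - p0.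
have p0E x : p0 x = p (e x) by rewrite comp_lfunE.
have p1E x : p1 x = p x - p (e x) by rewrite add_lfunE opp_lfunE p0E.
have p00 x : p0 (p0 x) = p0 x by rewrite !p0E -ecp ee pp.
have p01 x : p0 (p1 x) = 0.
  by rewrite p0E p1E !linearB /= -!ecp ee !pp subrr.
have p10 x : p1 (p0 x) = 0 by rewrite p1E p0E -!ecp ee !pp subrr.
have p11 x : p1 (p1 x) = p1 x.
  by rewrite {1}/p1 add_lfunE opp_lfunE p01 subr0 p1E linearB /= !pp.
have subp (r : 'End(L)) : (forall x, p (r x) = r x) -> (limg r <= limg p)%VS.
  by move=> pr; apply/subvP=> _ /memv_imgP[x _ ->]; rewrite -pr memv_img ?memvf.
have pp0 x : p (p0 x) = p0 x by rewrite p0E pp.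
have pp1 x : p (p1 x) = p1 x by rewrite p1E linearB /= !pp.
have [ws0 [q0 W0]] : exists ws q, wdec p0 ws q.
  apply: IH => // [|s x]; last by rewrite !p0E pc ec.
  apply: leq_trans pd; rewrite (ltn_leqif (dimv_leqif_sup (subp _ pp0))).
  apply/negP=> /subvP s; apply: (nsingle a) => x; exists (\dim {:L}).
  have := s (p x); rewrite !limg_idemE // pp eqxx => /(_ isT)/eqP <-.
  by rewrite p0E ecp eN.
have [ws1 [q1 W1]] : exists ws q, wdec p1 ws q.
  apply: IH => // [|s x]; last by rewrite !p1E brBr // !pc ec.
  apply: leq_trans pd; rewrite (ltn_leqif (dimv_leqif_sup (subp _ pp1))).
  apply/negP=> /subvP s; have := s y; rewrite !limg_idemE // py eqxx => /(_ isT).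
  by rewrite p1E ey py subrr eq_sym (negPf y0).
exists (undup (ws0 ++ ws1)), (fun l => q0 l + q1 l).
have -> : p = p0 + p1 by rewrite addrC subrK.
exact: wdec_add.
Qed.

End WeightDecomposition.

(** * Automorphisms of finite order *)

(** Cauchy product regrouped by total degree; the bound [n + n] is ample, as a term survives only
    when both indices are below [n]. *)
Lemma sum_square_triangle (V : nmodType) (G : nat -> nat -> V) n :
    (forall i j, (n <= i)%N || (n <= j)%N -> G i j = 0) ->
  \sum_(0 <= k < n + n) \sum_(0 <= i < k.+1) G i (k - i)%N =
  \sum_(0 <= i < n) \sum_(0 <= j < n) G i j.
Proof.
move=> G0; pose T i k := if (i <= k)%N then G i (k - i)%N else 0.
have -> : \sum_(0 <= k < n + n) \sum_(0 <= i < k.+1) G i (k - i)%N =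
    \sum_(0 <= k < n + n) \sum_(0 <= i < n + n) T i k.
  rewrite !big_nat; apply: eq_bigr => k /andP[_ kn].
  rewrite (big_nat_widen _ _ _ _ _ kn) big_mkcond; apply: eq_bigr => i _.
  by rewrite /T ltnS.
rewrite exchange_big /= (big_cat_nat (n := n)) ?leq_addr //=.
rewrite [X in _ + X]big1_seq ?addr0 => [|i]; last first.
  rewrite mem_index_iota => /and3P[_ ni _]; apply: big1 => k _.
  by rewrite /T; case: ifP => // _; rewrite G0 ?ni.
rewrite !big_nat; apply: eq_bigr => i /andP[_ ilt].
have ile : (i <= n + n)%N by rewrite (leq_trans (ltnW ilt)) ?leq_addr.
rewrite (big_cat_nat (n := i)) //= big_nat big1 ?add0r => [|k /andP[_ ki]]; last first.
  by rewrite /T leqNgt ki.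
rewrite -{1}[i]add0n big_addn (big_cat_nat (n := n)) //=; last first.
  by rewrite leq_subRL ?leq_add2r // ltnW.
rewrite [X in _ + X]big1_seq ?addr0 => [|k]; last first.
  rewrite mem_index_iota => /and3P[_ nk _].
  by rewrite /T leq_addl addnK G0 ?nk ?orbT.
by apply: eq_bigr => j _; rewrite /T leq_addl addnK.
Qed.

Section Automorphisms.
Variables (F : fieldType) (L : vectType F) (br : L -> L -> L).
Hypotheses (charF0 : [pchar F] =i pred0) (Hlie : lie_bracket br).

(** The divided powers [E k] of the derivation [ad x] satisfy the Leibniz rule without binomial
    coefficients, so their sum is multiplicative by a Cauchy product. *)
Lemma exp_ad_morph x u v : ad_nilpotent br x ->
  exp_ad br x (br u v) = br (exp_ad br x u) (exp_ad br x v).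
Proof.
move=> [n0 adn]; set D := ad br x in adn; set n := (\dim {:L}).+1.
pose E k y := (k`!%:R : F)^-1 *: lpow D k y.
have natF k : (k.+1%:R : F) != 0 by rewrite (pcharf0P F).1.
have ES k y : k.+1%:R *: E k.+1 y = D (E k y).
  by rewrite /E lfunZ -lpowSE scalerA factS natrM invfM mulrA divff ?mul1r.
have E0 k y : (n <= k)%N -> E k y = 0.
  move=> nk; rewrite /E (lpow_eq0_leq (ltnW nk)) ?scaler0 //.
  by apply: (@lpow_eq0_dim _ _ _ n0); rewrite adn zero_lfunE.
have Dbr y z : D (br y z) = br (D y) z + br y (D z).
  by rewrite !(adE Hlie) (jacobi Hlie).
have Ebr k y z : E k (br y z) = \sum_(0 <= i < k.+1) br (E i y) (E (k - i)%N z).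
  elim: k => [|k IH].
    by rewrite big_nat1 /E !lpow0E fact0 invr1 !scale1r.
  (* After multiplication by [k.+1], the two halves of the Leibniz rule carry the coefficients [i]
     and [k.+1 - i], which add up to [k.+1]. *)
  apply: (scalerI (natF k)); rewrite ES IH linear_sum /=.
  under eq_bigr => i _ do
    rewrite Dbr -!ES (brZl Hlie i.+1%:R) (brZr Hlie (k - i).+1%:R).
  rewrite big_split /=.
  have -> : \sum_(0 <= i < k.+1) i.+1%:R *: br (E i.+1 y) (E (k - i)%N z) =
      \sum_(0 <= i < k.+2) i%:R *: br (E i y) (E (k.+1 - i)%N z).
    by rewrite [RHS]big_nat_recl // scale0r add0r.
  have -> : \sum_(0 <= i < k.+1) (k - i).+1%:R *: br (E i y) (E (k - i).+1 z) =
      \sum_(0 <= i < k.+2) (k.+1 - i)%:R *: br (E i y) (E (k.+1 - i)%N z).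
    rewrite [RHS]big_nat_recr //= subnn scale0r addr0 !big_nat.
    by apply: eq_bigr => i /andP[_ ik]; rewrite subSn.
  rewrite -big_split scaler_sumr !big_nat; apply: eq_bigr => i /andP[_ ik] /=.
  by rewrite -scalerDl -natrD subnKC.
have expE y : exp_ad br x y = \sum_(0 <= k < n) E k y.
  by rewrite big_mkord sum_lfunE; apply: eq_bigr => k _; rewrite scale_lfunE.
rewrite !expE (br_suml Hlie).
under [RHS]eq_bigr => i _ do rewrite (br_sumr Hlie).
rewrite -(@sum_square_triangle _ (fun i j => br (E i u) (E j v))); last first.
  by move=> i j /orP[] /E0 ->; rewrite ?(br0l Hlie) ?(br0r Hlie).
rewrite [RHS](big_cat_nat (n := n)) ?leq_addr //= [X in _ + X]big1_seq ?addr0.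
  by apply: eq_bigr => k _; rewrite Ebr.
move=> k; rewrite mem_index_iota => /and3P[_ nk _].
by rewrite -Ebr E0.
Qed.

Lemma adjoint_group_morph sigma u v : in_adjoint_group br sigma ->
  sigma (br u v) = br (sigma u) (sigma v).
Proof.
move=> [s [snil ->]]; elim: s snil => [|x s IH] snil /=; first by rewrite !id_lfunE.
rewrite !comp_lfunE IH => [|y ys]; last by apply: snil; rewrite inE ys orbT.
by apply: exp_ad_morph; apply: snil; rewrite mem_head.
Qed.

End Automorphisms.

(** The average of the powers of [f] is an idempotent whose image is the fixed space, so its trace
    is the dimension. *)
Lemma dim_fixedSpace (F : fieldType) (V : vectType F) (f : 'End(V)) m :
    [pchar F] =i pred0 -> (0 < m)%N -> lpow f m = \1%VF ->
  m%:R * (\dim (fixedSpace f))%:R = \sum_(k < m) ltrace (lpow f k).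
Proof.
move=> charF0 m0 fm; have mF : (m%:R : F) != 0 by rewrite (pcharf0P F).1 // -lt0n.
pose A : 'End(V) := m%:R^-1 *: \sum_(k < m) lpow f k.
have AE x : A x = m%:R^-1 *: \sum_(k < m) lpow f k x.
  by rewrite scale_lfunE sum_lfunE.
have fA x : f (A x) = A x.
  rewrite AE lfunZ linear_sum /=; congr (_ *: _).
  under eq_bigr => k _ do rewrite -lpowSE.
  case: m m0 fm {mF A AE} => // m _ fm.
  rewrite big_ord_recr [RHS]big_ord_recl addrC; congr (_ + _).
  by rewrite -[LHS]/(lpow f m.+1 x) fm id_lfunE.
have Afix x : f x = x -> A x = x.
  move=> fx; rewrite AE (eq_bigr (fun=> x)) => [|k _].
    by rewrite sumr_const card_ord -scaler_nat scalerA mulVf ?scale1r.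
  by elim: (k : nat) => [|j IH]; rewrite ?lpow0E // lpowSE IH.
have -> : fixedSpace f = limg A.
  apply/vspaceP=> x; apply/fixedSpaceP/memv_imgP => [fx|[y _ ->]]; last exact: fA.
  by exists x; rewrite ?memvf ?Afix.
rewrite -ltrace_idem => [|x]; last by rewrite Afix.
by rewrite linearZ linear_sum /= mulVKf.
Qed.

(** * The Killing form and root strings *)

Section WeightSpaces.
Variables (F : closedFieldType) (L : vectType F) (br : L -> L -> L).
Hypotheses (charF0 : [pchar F] =i pred0) (Hlie : lie_bracket br).
Variable h : {vspace L}.
Hypothesis Hcartan : cartan_subalgebra br h.
Local Notation H := (subvs_of h).
Local Notation wt := 'Hom(subvs_of h, F^o).
Local Notation ad := (ad br).
Variables (ws : seq wt) (q : wt -> 'End(L)).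
Hypothesis W : wdec br \1%VF ws q.
Hypothesis wsE : forall l, (l \in ws) = (q l != 0).
Implicit Types (t s : H) (l mu : wt) (x y : L).

Lemma q_sum x : \sum_(l <- ws) q l x = x.
Proof. by rewrite (wdec_sum W) id_lfunE. Qed.

Lemma qq l x : q l (q l x) = q l x.
Proof. by rewrite (wdec_orth W) eqxx. Qed.

Lemma q_orth l mu x : l != mu -> q mu x = x -> q l x = 0.
Proof. by move=> /negPf lm <-; rewrite (wdec_orth W) lm. Qed.

(** Two distinct weights differ at some [t], and there [shf_pow_disjoint] kills the components of
    [x] in the other weight spaces. *)
Lemma gen_q l x : gen br l x <-> q l x = x.
Proof.
split=> [gx|<-]; last exact: wdec_gen W _ _.
rewrite -[RHS]q_sum (sum_delta (i := l)) ?(wdec_uniq W) //.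
  by move=> /(wdec_out W) ->; rewrite zero_lfunE.
move=> mu /eqP ml.
have [t /eqP tml] : exists t : H, mu t <> l t.
  by apply/existsNP => e; apply: ml; apply/lfunP.
have [k xk] := gx t; have [k' yk] := wdec_gen W mu x t.
apply: (shf_pow_disjoint Hlie tml yk (l := k)).
rewrite (lpow_comm (g := q mu)) ?xk ?linear0 // => z.
by rewrite !shfE // (wdec_comm W) linearB /= lfunZ.
Qed.

Lemma q_br l mu x y : q l x = x -> q mu y = y -> q (l + mu) (br x y) = br x y.
Proof.
move=> /gen_q gx /gen_q gy; apply/gen_q => t.
have [k xk] := gx t; have [k' yk] := gy t; exists (k + k')%N.
by rewrite add_lfunE; apply: shf_pow_br.
Qed.

(** If the generalized 0-weight space were larger than [h], Engel's theorem on the quotient would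
    give [y] outside [h] with [[h, y]] inside [h], against self-normalization. *)
Lemma q_0E x : (q 0 x = x) <-> x \in h.
Proof.
have [Hnil Hself] := Hcartan; have [hsub _] := Hnil.
have hq (s : L) : s \in h -> q 0 s = s.
  move=> sh; apply/gen_q => t; rewrite zero_lfunE.
  by have := br_nilp_sub Hlie Hnil t (vsproj h s); rewrite vsprojK.
split=> [q0x|]; last exact: hq.
apply: contrapT => xh.
have [|||||||y [q0y yh] hy] := @engel _ _ _ Hlie h ad (fun x => q 0 x = x) (fun x => x \in h) Hnil.
- move=> a u v; apply/lfunP=> z.
  by rewrite add_lfunE scale_lfunE !adE // brPl.
- by move=> s r z sh rh; rewrite !adE // jacobi // addrC.
- move=> s z /hq q0s q0z; rewrite adE //.
  by rewrite -[X in q X _](addr0 0) q_br.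
- by move=> s z sh zh; rewrite adE // hsub.
- split=> [|a u v]; first by apply/asboolP; apply: mem0v.
  by move=> /asboolP uh /asboolP vh; apply/asboolP; rewrite rpredD ?rpredZ.
- move=> s z sh /gen_q /(_ (vsproj h s)) [k]; rewrite zero_lfunE vsprojK // => zk.
  exists k; have -> : ad s = shf br s 0 by rewrite /shf scale0r subr0.
  by rewrite zk mem0v.
- by exists x.
by case: yh; apply: Hself => s sh; rewrite brC // -adE // rpredN hy.
Qed.

Lemma q0_val t : q 0 (vsval t) = vsval t.
Proof. by apply/q_0E/subvsP. Qed.

Lemma br_opp_in_h l x y : q l x = x -> q (- l) y = y -> br x y \in h.
Proof. by move=> qx qy; apply/q_0E; rewrite -[X in q X _](addrN l) q_br. Qed.

Definition wdim l := \dim (limg (q l)).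

Lemma wdim_gt0 l : (0 < wdim l)%N = (l \in ws).
Proof.
rewrite wsE lt0n dimv_eq0; congr (~~ _); apply/eqP/eqP=> [e|->]; last exact: lim0g.
apply/lfunP=> x; rewrite zero_lfunE; apply/eqP.
by rewrite -memv0 -e memv_img ?memvf.
Qed.

Lemma mem_ws l x : q l x = x -> x != 0 -> l \in ws.
Proof.
move=> qx; apply: contraNT; rewrite wsE negbK => /eqP q0.
by rewrite -qx q0 zero_lfunE.
Qed.

Lemma ltrace_q l : ltrace (q l) = (wdim l)%:R.
Proof. by apply: ltrace_idem; apply: qq. Qed.

Lemma ltrace_sum (f : 'End(L)) : ltrace f = \sum_(l <- ws) ltrace (f \o q l)%VF.
Proof.
rewrite -linear_sum /=; congr (ltrace _); apply/lfunP=> x.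
rewrite sum_lfunE -[in LHS](q_sum x) linear_sum; apply: eq_bigr => l _.
by rewrite comp_lfunE.
Qed.

Lemma ltrace_q0 (f : 'End(L)) l : (forall x, q l x = x -> q l (f x) = 0) ->
  ltrace (f \o q l)%VF = 0.
Proof.
move=> fl; have -> : (f \o q l = (f \o q l) \o q l)%VF.
  by apply/lfunP=> x; rewrite !comp_lfunE qq.
rewrite ltraceC; have -> : (q l \o (f \o q l))%VF = 0; last exact: linear0.
by apply/lfunP=> x; rewrite !comp_lfunE zero_lfunE fl // qq.
Qed.

(** [shf t (l t)] is nilpotent on the weight space and stays so after composition with a commuting
    [g]. The cases [g = 1] and [g = ad t] give the traces of [ad t] and of its square. *)
Lemma ltrace_shf t l (g : 'End(L)) :
    (forall x, q l (g x) = g (q l x)) ->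
    (forall x, g (br (vsval t) x) = br (vsval t) (g x)) ->
  ltrace ((g \o shf br (vsval t) (l t)) \o q l)%VF = 0.
Proof.
move=> gq gt; set N := shf _ _ _.
have Nq x : N (q l x) = q l (N x).
  by rewrite !shfE // (wdec_comm W) linearB /= lfunZ.
have gN x : N (g x) = g (N x) by rewrite !shfE // linearB /= lfunZ gt.
apply: (@ltrace_nilp _ _ _ _ (\dim {:L})) => [x|x|x]; first exact: qq.
  by rewrite !comp_lfunE Nq gq.
have [k /lpow_eq0_dim qk] := wdec_gen W l x t.
have E j y : lpow (g \o N)%VF j y = lpow g j (lpow N j y).
  elim: j y => [|j IH] y; first by rewrite !lpow0E.
  rewrite lpowSrE IH comp_lfunE (lpow_comm (g := g)) // -lpowSrE.
  by rewrite -lpowSrE.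
by rewrite E qk linear0.
Qed.

Lemma ltrace_ad t l : ltrace (ad (vsval t) \o q l)%VF = l t * (wdim l)%:R.
Proof.
have := @ltrace_shf t l \1%VF; rewrite comp_lfun1l => /(_ _ _)/eqP.
rewrite comp_lfunDl comp_lfunNl -comp_lfunZl comp_lfun1l linearB linearZ /=.
rewrite ltrace_q subr_eq0 => e; apply/eqP/e => x; by rewrite !id_lfunE.
Qed.

Lemma ltrace_ad2 t l :
  ltrace ((ad (vsval t) \o ad (vsval t)) \o q l)%VF = (l t) ^+ 2 * (wdim l)%:R.
Proof.
have := @ltrace_shf t l (ad (vsval t)) => /(_ _ _)/eqP.
rewrite comp_lfunDr comp_lfunNr -comp_lfunZr comp_lfun1r.
rewrite comp_lfunDl comp_lfunNl -comp_lfunZl linearB linearZ /= ltrace_ad.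
rewrite subr_eq0 mulrA -expr2 => e; apply/eqP/e => x; rewrite !adE //.
by rewrite (wdec_comm W).
Qed.

Definition killing x y : F := ltrace (ad x \o ad y)%VF.

Lemma killingC x y : killing x y = killing y x.
Proof. exact: ltraceC. Qed.

Lemma killingPr a x y z : killing z (a *: x + y) = a * killing z x + killing z y.
Proof.
rewrite /killing -linearP; congr (ltrace _); apply/lfunP=> u.
rewrite add_lfunE scale_lfunE !comp_lfunE !adE // brPl // brDr //.
by rewrite brZr.
Qed.

Lemma killingDr x y z : killing z (x + y) = killing z x + killing z y.
Proof. by have := killingPr 1 x y z; rewrite scale1r mul1r. Qed.
Lemma killing0r z : killing z 0 = 0.
Proof. by have /eqP := killingDr 0 0 z; rewrite addr0 -subr_eq subrr => /eqP. Qed.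
Lemma killingZr a x z : killing z (a *: x) = a * killing z x.
Proof. by have := killingPr a x 0 z; rewrite !killing0r !addr0. Qed.

Lemma killing_sumr (I : Type) (r : seq I) (P : pred I) (G : I -> L) x :
  killing x (\sum_(i <- r | P i) G i) = \sum_(i <- r | P i) killing x (G i).
Proof.
by elim/big_rec2: _ => [|i u v _ <-]; rewrite ?killing0r // killingDr.
Qed.

Lemma killing_br x y z : killing (br x y) z = killing x (br y z).
Proof.
rewrite /killing !ad_br // comp_lfunDl comp_lfunNl comp_lfunDr comp_lfunNr.
rewrite !linearB /= comp_lfunA; congr (_ - _).
by rewrite -comp_lfunA ltraceC comp_lfunA.
Qed.

Lemma killing_orth l mu x y :
  q l x = x -> q mu y = y -> l + mu != 0 -> killing x y = 0.
Proof.
move=> qx qy lm; rewrite /killing ltrace_sum big1 // => nu _.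
apply: ltrace_q0 => z qz; rewrite comp_lfunE !adE //.
apply: (@q_orth _ (l + (mu + nu))); last by apply: q_br => //; apply: q_br.
by rewrite addrA -{1}[nu]add0r (inj_eq (addIr _)) eq_sym.
Qed.

Lemma killing_tt t : killing (vsval t) (vsval t) = \sum_(l <- ws) l t ^+ 2 * (wdim l)%:R.
Proof. by rewrite /killing ltrace_sum; apply: eq_bigr => l _; rewrite ltrace_ad2. Qed.

(** Polarization of [killing_tt]: [ltrace_shf] does not apply to [g = ad s], since [s] and [t] are
    not known to commute. *)
Lemma killing_hh t s :
  killing (vsval t) (vsval s) = \sum_(l <- ws) l t * l s * (wdim l)%:R.
Proof.
have n2 : 2%:R != 0 :> F by rewrite natf_eq0.
have := killing_tt (t + s); rewrite linearD /= killingDr.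
rewrite killingC killingDr killing_tt [killing (_ + _) (vsval s)]killingC killingDr killing_tt.
rewrite [killing (vsval s) _]killingC.
have -> : \sum_(l <- ws) l (t + s) ^+ 2 * (wdim l)%:R =
  \sum_(l <- ws) l t ^+ 2 * (wdim l)%:R + \sum_(l <- ws) l s ^+ 2 * (wdim l)%:R +
  2%:R * \sum_(l <- ws) l t * l s * (wdim l)%:R.
  rewrite mulr_sumr -!big_split /=; apply: eq_bigr => l _.
  rewrite linearD /=; have E (a b d : F) :
    (a + b) ^+ 2 * d = a ^+ 2 * d + b ^+ 2 * d + 2%:R * (a * b * d) by ring.
  exact: E.
set A := \sum_(l <- ws) l t ^+ 2 * _; set B := \sum_(l <- ws) l s ^+ 2 * _.
set C := killing _ _ => E; apply: (mulfI n2).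
apply: (addrI (A + B)); rewrite -E mulr_natl mulr2n addrACA.
by rewrite [B + C]addrC.
Qed.

Definition qset (S : pred wt) : 'End(L) := \sum_(l <- ws | S l) q l.

Lemma qset_q S l x : q l x = x -> qset S x = if S l then x else 0.
Proof.
move=> qx; rewrite sum_lfunE big_mkcond /= (sum_delta (i := l)) ?(wdec_uniq W) ?qx //.
  move=> /(wdec_out W) q0; move: qx; rewrite q0 zero_lfunE => <-.
  by rewrite if_same.
by move=> mu ml; rewrite (q_orth ml qx) if_same.
Qed.

Lemma qset_br_comm S l e x :
    q l e = e -> (forall mu, S (l + mu) = S mu) ->
  br e (qset S x) = qset S (br e x).
Proof.
move=> qe SE; rewrite -[x]q_sum linear_sum !br_sumr // linear_sum.
apply: eq_bigr => mu _ /=; rewrite (@qset_q _ mu) ?qq //.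
rewrite (@qset_q _ (l + mu)) ?SE; last by apply: q_br; rewrite ?qq.
by case: (S mu); rewrite ?br0r.
Qed.

Lemma comp_qset (f : 'End(L)) S : (f \o qset S)%VF = \sum_(l <- ws | S l) (f \o q l)%VF.
Proof.
apply/lfunP=> x; rewrite comp_lfunE !sum_lfunE linear_sum.
by apply: eq_bigr => l _; rewrite comp_lfunE.
Qed.

(* [ad (br e f)] is a commutator on the [alpha]-string through [beta], so its
   trace there vanishes. *)
Lemma string_trace (alpha beta : wt) e f t :
    q alpha e = e -> q (- alpha) f = f -> vsval t = br e f -> beta \in ws ->
  exists (N : nat) (K : int), N != 0%N /\ N%:R * beta t = K%:~R * alpha t :> F.
Proof.
move=> qe qf tE wb.
pose S l := `[< exists k : int, l = beta + k%:~R *: alpha >].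
have Se l : S (alpha + l) = S l.
  apply/asboolP/asboolP => -[k E].
    exists (k - 1); apply: (addrI alpha); rewrite E rmorphB /= scalerBl scale1r.
    by rewrite [RHS]addrCA [alpha + (_ - _)]addrC subrK.
  by exists (k + 1); rewrite E rmorphD /= scalerDl scale1r addrC addrA.
have Sf l : S (- alpha + l) = S l by rewrite -Se addrA subrr add0r.
have tr0 : ltrace (ad (vsval t) \o qset S)%VF = 0.
  have ce x : br e (qset S x) = qset S (br e x) by apply: qset_br_comm qe Se.
  have cf x : br f (qset S x) = qset S (br f x) by apply: qset_br_comm qf Sf.
  rewrite tE ad_br // comp_lfunDl comp_lfunNl linearB /=; apply/eqP.
  rewrite subr_eq0; apply/eqP; rewrite -!comp_lfunA (ltraceC (ad e)).
  congr (ltrace _); apply/lfunP=> x; rewrite !comp_lfunE !adE //.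
  by rewrite ce.
have /choice[kk kkP] : forall l, exists k : int, S l -> l = beta + k%:~R *: alpha.
  move=> l; case: (pselect (S l)) => [/asboolP[k E]|nS]; first by exists k.
  by exists 0.
have trE : ltrace (ad (vsval t) \o qset S)%VF =
    \sum_(l <- ws | S l) (beta t + (kk l)%:~R * alpha t) * (wdim l)%:R.
  rewrite comp_qset linear_sum /=; apply: eq_bigr => l Sl.
  by rewrite ltrace_ad {1}(kkP l Sl) add_lfunE scale_lfunE.
(* [N] is the dimension of the string, positive because [beta] lies on it; [K] is minus the sum of
   the string positions, weighted by dimension. *)
pose N := (\sum_(l <- ws | S l) wdim l)%N.
pose K : int := - \sum_(l <- ws | S l) kk l * (wdim l)%:Z.
exists N, K; split.
  have Sb : S beta by apply/asboolP; exists 0; rewrite scale0r addr0.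
  rewrite -lt0n /N -big_filter (bigD1_seq beta) /= ?filter_uniq ?(wdec_uniq W) //.
    by rewrite ltn_addr // wdim_gt0.
  by rewrite mem_filter Sb.
move: tr0; rewrite trE; under eq_bigr do rewrite mulrDl.
rewrite big_split /= -mulr_sumr -natr_sum mulrC => /eqP; rewrite addr_eq0 => /eqP ->.
rewrite /K rmorphN rmorph_sum /= mulNr mulr_suml; congr (- _).
by apply: eq_bigr => l _; rewrite rmorphM /= mulrAC -pmulrn.
Qed.

Lemma common_denominator (I : eqType) (r : seq I) (b : I -> F) (a : F) :
    (forall i, i \in r -> exists (N : nat) (K : int),
       N != 0%N /\ N%:R * b i = K%:~R * a) ->
  exists (D : nat) (M : I -> int),
    D != 0%N /\ forall i, i \in r -> D%:R * b i = (M i)%:~R * a.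
Proof.
elim: r => [_|i r IH Hr]; first by exists 1%N, (fun=> 0).
have [|D [M [D0 DM]]] := IH; first by move=> j jr; apply: Hr; rewrite inE jr orbT.
have [N [K [N0 NK]]] := Hr i (mem_head _ _).
exists (D * N)%N, (fun j => if j == i then K * D%:Z else M j * N%:Z).
split=> [|j]; first by rewrite muln_eq0 negb_or D0.
rewrite inE; case: eqP => [-> _|_ /= jr].
  by rewrite natrM -mulrA NK rmorphM /= -pmulrn mulrA [D%:R * _]mulrC.
by rewrite natrM mulrAC DM // rmorphM /= -pmulrn mulrAC.
Qed.

Lemma sqr_intr (k : int) : (k%:~R : F) ^+ 2 = (`|k|%N ^ 2)%:R.
Proof.
case: k => n; first by rewrite -pmulrn natrX.
by rewrite /= NegzE rmorphN /= sqrrN -pmulrn natrX.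
Qed.

Lemma sum_nat_eq0 (r : seq wt) (G : wt -> nat) l :
  \sum_(i <- r) (G i)%:R = 0 :> F -> l \in r -> G l = 0%N.
Proof.
rewrite -natr_sum => /eqP; rewrite natf_eq0 // => /eqP s0 lr.
apply/eqP; rewrite -leqn0 -[X in (_ <= X)%N]s0.
by rewrite (big_rem l) //= leq_addr.
Qed.

Lemma string_weights (alpha : wt) e f t :
    q alpha e = e -> q (- alpha) f = f -> vsval t = br e f ->
  exists (D : nat) (M : wt -> int),
    D != 0%N /\ forall beta, beta \in ws -> D%:R * (beta t : F) = (M beta)%:~R * alpha t.
Proof.
move=> qe qf tE; apply: common_denominator => beta wb.
exact: string_trace qe qf tE wb.
Qed.

Lemma weights_vanish (alpha : wt) e f t :
    q alpha e = e -> q (- alpha) f = f -> vsval t = br e f -> alpha t = 0 ->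
  forall beta, beta \in ws -> beta t = 0.
Proof.
move=> qe qf tE a0 beta wb; have [D [M [D0 /(_ _ wb)]]] := string_weights qe qf tE.
rewrite a0 mulr0 => /eqP; rewrite mulf_eq0 natf_eq0 // (negPf D0) /=.
by move/eqP.
Qed.

(** With [D * l t = M l * alpha t], the number [D^2 * killing t t] equals [(alpha t)^2] times the
    sum of [(M l)^2 * wdim l]. If [alpha t] were nonzero, the term at [alpha] would force
    [M alpha = 0], hence [alpha t = 0]. *)
Lemma isotropic_weights_vanish (alpha : wt) e f t :
    q alpha e = e -> q (- alpha) f = f -> vsval t = br e f ->
    killing (vsval t) (vsval t) = 0 ->
  forall beta, beta \in ws -> beta t = 0.
Proof.
move=> qe qf tE; have [e0|/(mem_ws qe) wa] := eqVneq e 0.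
  move=> _ beta _; suff -> : t = 0 by rewrite linear0.
  by apply/subvs_inj; rewrite tE e0 br0l // linear0.
move=> k0; apply: (weights_vanish qe qf tE); apply/eqP/contraT => a0.
have [D [M [D0 DM]]] := string_weights qe qf tE.
have : \sum_(l <- ws) (`|M l|%N ^ 2 * wdim l)%:R = 0 :> F.
  apply: (mulfI (@expf_neq0 F _ 2 a0)); rewrite mulr0 -[RHS](mulr0 (D%:R ^+ 2)) -[in RHS]k0.
  rewrite killing_tt !mulr_sumr; apply: eq_big_seq => l wl.
  have E (a b d D' m : F) : D' * b = m * a -> a ^+ 2 * (m ^+ 2 * d) = D' ^+ 2 * (b ^+ 2 * d).
    by move=> Db; transitivity ((m * a) ^+ 2 * d); last rewrite -Db; ring.
  by rewrite natrM -sqr_intr; apply/E/DM.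
move=> /sum_nat_eq0/(_ wa)/eqP.
rewrite muln_eq0 (gtn_eqF (_ : 0 < wdim alpha)%N) ?wdim_gt0 // orbF expn_eq0 andbT.
rewrite absz_eq0 => /eqP Ma.
have /eqP := DM _ wa; rewrite Ma mul0r mulf_eq0 natf_eq0 // (negPf D0) /=.
by rewrite (negPf a0).
Qed.

(** * Nondegeneracy of the Killing form of a simple algebra *)

Hypothesis Hsimple : simple_lie br.

Lemma bracket_full : bracket_space br fullv fullv = fullv.
Proof.
have [[x [y xy]] ideals] := Hsimple.
have [|e|//] := ideals (bracket_space br fullv fullv).
  by move=> u v _; apply: bracket_space_mem; rewrite ?memvf.
have := bracket_space_mem Hlie (memvf x) (memvf y).
by rewrite e memv0 (negPf xy).
Qed.

(** If the form were zero, each weight would vanish on every [[g_l, g_(- l)]]. Extended by 0 on the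
    other weight spaces, it would vanish on [[g, g] = g]. All weights being 0, [h] would be the
    whole algebra, which is not nilpotent. *)
Lemma killing_neq0 : exists x y, killing x y != 0.
Proof.
apply: contrapT => /forallNP k0.
have {}k0 x y : killing x y = 0.
  by apply/eqP/contraT => kxy; case: (k0 x); exists y.
have ws0 beta : beta \in ws -> beta = 0.
  move=> wb; pose z : 'Hom(L, F^o) := (beta \o (linfun (vsproj h) \o q 0))%VF.
  have zE x : z x = beta (vsproj h (q 0 x)) by rewrite !comp_lfunE lfunE.
  have : (fullv <= lker z)%VS.
    rewrite -bracket_full; apply/span_subvP=> _ /allpairsP[[u v] /= [_ _ ->]].
    rewrite memv_ker -[u]q_sum -[v]q_sum br_suml // linear_sum; apply/eqP/big1 => l _.
    rewrite br_sumr // linear_sum; apply: big1 => mu _; rewrite /= zE.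
    have [lm0|lm0] := eqVneq (l + mu) 0; last first.
      rewrite (@q_orth _ (l + mu)) ?linear0 1?eq_sym //.
      by apply: q_br; rewrite qq.
    have muE : mu = - l by apply/eqP; rewrite -addr_eq0 addrC lm0.
    have brh : br (q l u) (q mu v) \in h.
      by apply: (@br_opp_in_h l); rewrite -?muE qq.
    rewrite (q_0E _).2 //; apply: (@isotropic_weights_vanish l (q l u) (q mu v)) => //.
    - exact: qq.
    - by rewrite -muE qq.
    - by rewrite vsprojK.
  move=> /subvP z0; apply/lfunP=> t; rewrite zero_lfunE.
  have := z0 (vsval t) (memvf _); rewrite memv_ker zE q0_val vsvalK.
  by move/eqP.
have hf : h = fullv.
  apply/vspaceP=> x; rewrite memvf; apply/q_0E.
  rewrite -[RHS]q_sum (sum_delta (i := 0)) ?(wdec_uniq W) //.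
    by move=> /(wdec_out W) ->; rewrite zero_lfunE.
  move=> l l0; rewrite (wdec_out W) ?zero_lfunE //.
  by apply: contraNN l0 => /ws0 ->.
have [[_ [n hn]] _] := Hcartan; have [[x [y xy]] _] := Hsimple.
have lcs_full : lcs br h n = fullv.
  by rewrite hf; elim: (n) => //= k ->; apply: bracket_full.
move/vspaceP: hn => /(_ (br x y)); rewrite lcs_full memvf memv0 (negPf xy).
by [].
Qed.

(** The radical is an ideal by invariance of the form, and it is not everything by
    [killing_neq0]. *)
Lemma killing_nondeg x : (forall y, killing y x = 0) -> x = 0.
Proof.
pose K y : 'Hom(L, F^o) := linfun (fun x => killing y x : F^o).
have KE y z : K y z = killing y z.
  by apply: linear_linfunE => a u v; rewrite killingPr.
pose R := (\bigcap_(i < \dim {:L}) lker (K (vbasis {:L})`_i))%VS.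
have RE z : (z \in R) <-> forall y, killing y z = 0.
  split=> [/subv_bigcapP zR y|zk]; last first.
    by apply/subv_bigcapP => i _; rewrite -memvE memv_ker KE zk.
  rewrite (coord_vbasis (memvf y)) killingC killing_sumr big1 // => i _.
  have := zR i isT; rewrite -memvE memv_ker KE killingZr killingC => /eqP ->.
  exact: mulr0.
have [_ /(_ R)[]] := Hsimple.
- by move=> u v /RE vR; apply/RE => y; rewrite -killing_br vR.
- by move=> R0 /RE; rewrite R0 memv0 => /eqP.
move=> Rf; have [u [v]] := killing_neq0.
have /RE -> : v \in R by rewrite Rf memvf.
by rewrite eqxx.
Qed.

Lemma killing_nondeg_h x : x \in h -> (forall t, killing (vsval t) x = 0) -> x = 0.
Proof.
move=> /q_0E xh x0; apply: killing_nondeg => y; rewrite -[y]q_sum killingC killing_sumr.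
apply: big1 => l _; have [->|l0] := eqVneq l 0.
  have yh : q 0 y \in h by apply/q_0E; rewrite qq.
  by rewrite killingC -(vsprojK yh) x0.
by apply: (killing_orth xh (qq l y)); rewrite add0r.
Qed.

(** * Weight vectors and one-dimensionality of the root spaces *)

(** A commutator has trace 0 on the weight space, where [t] has trace [alpha t * wdim alpha]. This
    makes [ad s - alpha s] a representation of [h], to which Engel's theorem applies in
    [ex_weight_vector]. *)
Lemma weight_commutator (alpha : wt) (s r t : H) :
  alpha \in ws -> vsval t = br (vsval s) (vsval r) -> alpha t = 0.
Proof.
move=> wa tE; have /eqP := ltrace_ad t alpha.
have -> : ltrace (ad (vsval t) \o q alpha)%VF = 0.
  rewrite tE ad_br // comp_lfunDl comp_lfunNl linearB /=; apply/eqP.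
  rewrite subr_eq0 -!comp_lfunA (ltraceC (ad (vsval s))); apply/eqP.
  congr (ltrace _); apply/lfunP=> x; rewrite !comp_lfunE !(adE Hlie).
  by rewrite !(wdec_comm W).
rewrite eq_sym mulf_eq0 natf_eq0 // (gtn_eqF (_ : 0 < wdim alpha)%N) ?wdim_gt0 //.
by rewrite orbF => /eqP.
Qed.

Lemma ex_weight_vector (alpha : wt) : alpha \in ws ->
  exists2 e, e != 0 & q alpha e = e /\ weight_vector br alpha e.
Proof.
have [Hnil _] := Hcartan; have [hsub _] := Hnil.
move=> wa; pose rho (s : L) := shf br s (alpha (vsproj h s)).
have rhoE (s x : L) : rho s x = br s x - alpha (vsproj h s) *: x by exact: shfE.
have [|||||||e [qe /eqP e0] he] :=
  @engel _ _ _ Hlie h rho (fun x => q alpha x = x) (fun x => x = 0) Hnil.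
- move=> a u v; apply/lfunP=> z; rewrite [RHS]add_lfunE [in RHS]scale_lfunE !rhoE.
  rewrite (brPl Hlie) !linearP /= scalerBr scalerDl scalerA opprD addrACA.
  by [].
- move=> s r z sh rh. rewrite !rhoE !(brBr Hlie) !(brZr Hlie).
  rewrite (@weight_commutator _ (vsproj h s) (vsproj h r) (vsproj h (br s r))) ?vsprojK ?hsub //.
  rewrite scale0r subr0 (jacobi Hlie s r) !scalerBr !scalerA.
  rewrite [_ * alpha (vsproj h s)]mulrC !opprB [RHS]addrC [in RHS]addrACA.
  by rewrite [- _ - _ in RHS]addrC -[in RHS]addrACA !addrA.
- move=> s z sh qz; rewrite rhoE linearB /= lfunZ.
  by have := wdec_comm W alpha (vsproj h s) z; rewrite vsprojK // => <-; rewrite qz.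
- by move=> s z _ ->; rewrite linear0.
- split=> [|a u v]; first exact/asboolP.
  by move=> /asboolP -> /asboolP ->; apply/asboolP; rewrite scaler0 addr0.
- move=> s z sh /gen_q /(_ (vsproj h s)) [k]; rewrite vsprojK // => zk.
  by exists k.
- move: wa; rewrite wsE => /lfunPn[x]; rewrite zero_lfunE => /eqP qx.
  by exists (q alpha x); rewrite ?qq.
exists e => //; split=> // t; have /eqP := he (vsval t) (subvsP t).
by rewrite rhoE vsvalK subr_eq0 => /eqP.
Qed.

(* With [ha := br e f] for a weight vector [e] of weight [alpha], the space
   [F e + F ha + \sum_(k >= 1) g_(- k alpha)] is stable under [e] and [f], so [ha] has
   trace [2 - 2 \sum_(k >= 1) k dim g_(- k alpha) = 0] on it. *)
Lemma wdim_opp (alpha : wt) : alpha \in ws -> alpha != 0 ->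
  - alpha \in ws /\ wdim (- alpha) = 1%N.
Proof.
move=> wa a0; have [e e0 [qe ewt]] := ex_weight_vector wa.
have [f0 qf0 kef0] : exists2 f0, q (- alpha) f0 = f0 & killing e f0 != 0.
  apply: contrapT => nf; move/eqP: e0; apply; apply: killing_nondeg => y.
  rewrite killingC -[y]q_sum killing_sumr; apply: big1 => l _.
  have [->|la] := eqVneq l (- alpha).
    apply/eqP/contraT => kl; case: nf; exists (q (- alpha) y) => //.
    exact: qq.
  by apply: (killing_orth qe (qq l y)); rewrite addrC addr_eq0.
have [t0 t0E] : exists t0 : H, vsval t0 = br e f0.
  by exists (vsproj h (br e f0)); rewrite vsprojK // (br_opp_in_h qe qf0).
have kt (f : L) t : killing (vsval t) (br e f) = alpha t * killing e f.
  by rewrite -killing_br ewt killingC killingZr killingC.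
(* If [alpha t0 = 0], all weights vanish at [t0], so [t0] is orthogonal to [h]; but
   [killing t t0 = alpha t * killing e f0], which would make [alpha] zero. *)
have at0 : (alpha t0 : F) != 0.
  apply: contraNneq a0 => at0; apply/eqP/lfunP=> t; rewrite zero_lfunE.
  have /eqP := kt f0 t; rewrite -t0E killing_hh big1_seq.
    by rewrite eq_sym mulf_eq0 (negPf kef0) orbF => /eqP.
  move=> l /andP[_ wl]; rewrite (weights_vanish qe qf0 t0E at0 wl).
  by rewrite mulr0 mul0r.
pose c : F := 2%:R / alpha t0; pose f := c *: f0; pose ha := c *: t0.
have n2 : 2%:R != 0 :> F by rewrite natf_eq0.
have c0 : c != 0 by rewrite mulf_neq0 ?invr_neq0.
have qf : q (- alpha) f = f by rewrite lfunZ qf0.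
have haE : vsval ha = br e f by rewrite linearZ /= t0E (brZr Hlie).
have aha : (alpha ha : F) = 2%:R by rewrite lfunZ -[LHS]/(c * alpha t0) divfK.
pose kef := killing e f.
have kef_neq0 : kef != 0 by rewrite /kef killingZr mulf_neq0.
have kha : killing (vsval ha) (vsval ha) = 2%:R * kef by rewrite {2}haE kt aha.
have n2kef : 2%:R * kef != 0 by rewrite mulf_neq0.
have nat_alpha k : k.+1%:R *: alpha != 0.
  by rewrite scaler_eq0 negb_or a0 natf_eq0.
(* [[e, y]] and [ha] both represent multiples of [alpha] through the Killing form on [h], which is
   nondegenerate; comparing multiples gives the coefficient. *)
have bre y : q (- alpha) y = y -> br e y = (killing e y / kef) *: vsval ha.
  move=> qy; apply/eqP; rewrite -subr_eq0; apply/eqP/killing_nondeg_h.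
    by rewrite rpredB ?rpredZ ?subvsP // (br_opp_in_h qe qy).
  move=> t; rewrite killingDr -scaleNr killingZr haE !kt -/kef.
  by rewrite mulNr mulrCA divfK // subrr.
(* Projections onto the lines of [e] and [ha], read off by pairing with [f] and [ha]; the
   denominators are [killing e f] and [killing ha ha = 2 * kef]. *)
pose Pe : 'End(L) := linfun (fun x => (killing f x / kef) *: e).
pose Ph : 'End(L) := linfun (fun x => (killing (vsval ha) x / (2%:R * kef)) *: vsval ha).
pose S (l : wt) := `[< exists k : nat, l = - (k.+1%:R *: alpha) >].
pose P : 'End(L) := Pe + Ph + qset S.
have lin y (d : F) (z : L) : linear (fun x => (killing y x / d) *: z).
  by move=> a u v; rewrite killingPr mulrDl scalerDl -mulrA scalerA.
have PeE x : Pe x = (killing f x / kef) *: e. exact: (linear_linfunE (lin f kef e) x).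
have PhE x : Ph x = (killing (vsval ha) x / (2%:R * kef)) *: vsval ha.
  exact: (linear_linfunE (lin _ _ _) x).
have PE x : P x = (killing f x / kef) *: e +
    (killing (vsval ha) x / (2%:R * kef)) *: vsval ha + qset S x.
  by rewrite !add_lfunE PeE PhE.
have Pid_e : P e = e.
  rewrite PE (killingC f) -/kef divff // scale1r.
  rewrite (killing_orth (q0_val ha) qe) ?add0r // mul0r scale0r addr0.
  rewrite (qset_q _ qe) ifN ?addr0 //; apply/asboolPn => -[k /eqP].
  by rewrite -addr_eq0 -{1}[alpha]scale1r -scalerDl -natr1 addrC natr1 natr1 (negPf (nat_alpha _)).
have Pid_ha : P (vsval ha) = vsval ha.
  rewrite PE kha divff // scale1r (killing_orth qf (q0_val ha)) ?addr0 ?oppr_eq0 //.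
  rewrite mul0r scale0r add0r (qset_q _ (q0_val ha)) ifN ?addr0 //.
  by apply/asboolPn => -[k /esym/eqP]; rewrite oppr_eq0 (negPf (nat_alpha _)).
have Pid_S l y : S l -> q l y = y -> P y = y.
  move=> Sl qy; rewrite PE (qset_q _ qy) Sl; case/asboolP: Sl => k lE.
  rewrite (killing_orth qf qy); last first.
    by rewrite lE -opprD oppr_eq0 -{1}[alpha]scale1r -scalerDl addrC natr1.
  rewrite (killing_orth (q0_val ha) qy); last by rewrite add0r lE oppr_eq0.
  by rewrite !mul0r !scale0r !add0r.
have PDZ a x y : P x = x -> P y = y -> P (a *: x + y) = a *: x + y.
  by move=> Px Py; rewrite linearP /= Px Py.
have Psum (G : wt -> L) : (forall l, S l -> P (G l) = G l) ->
    P (\sum_(l <- ws | S l) G l) = \sum_(l <- ws | S l) G l.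
  by move=> PG; rewrite linear_sum; apply: eq_bigr.
have S1 : S (- alpha) by apply/asboolP; exists 0%N; rewrite scale1r.
have stable_e x : P (br e (P x)) = br e (P x).
  rewrite (PE x) -addrA.
  rewrite (brPr Hlie) (brxx Hlie) scaler0 add0r (brPr Hlie) [br e (vsval ha)](brC Hlie) ewt aha.
  apply: (PDZ _ _ _); first by rewrite linearN /= lfunZ Pid_e.
  rewrite sum_lfunE (br_sumr Hlie); apply: (Psum _) => l /asboolP[[|k] lE].
    have la : l = - alpha by rewrite lE scale1r.
    by rewrite bre -?la ?qq // (lfunZ P (_ / _)) Pid_ha.
  apply: (@Pid_S (alpha + l)); last by apply: q_br; rewrite ?qq.
  apply/asboolP; exists k; rewrite lE -natr1 scalerDl scale1r opprD addrC.
  by rewrite subrK.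
have stable_f x : P (br f (P x)) = br f (P x).
  rewrite (PE x) -addrA.
  rewrite (brPr Hlie) [br f e](brC Hlie) -haE; apply: (PDZ _ _ _); first by rewrite linearN /= Pid_ha.
  rewrite (brPr Hlie); apply: (PDZ _ _ _).
    apply: (Pid_S _ _ S1); rewrite -{1}[- alpha]addr0.
    by apply: q_br => //; apply: q0_val.
  rewrite sum_lfunE (br_sumr Hlie); apply: (Psum _) => l /asboolP[k lE].
  apply: (@Pid_S (- alpha + l)); last by apply: q_br; rewrite ?qq.
  by apply/asboolP; exists k.+1; rewrite lE -opprD -[in RHS]natr1 scalerDl scale1r addrC.
have tr0 : ltrace (ad (vsval ha) \o P)%VF = 0.
  rewrite haE ad_br // comp_lfunDl comp_lfunNl linearB /=; apply/eqP; rewrite subr_eq0.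
  have -> : ((ad e \o ad f) \o P = (ad e \o P) \o (ad f \o P))%VF.
    by apply/lfunP=> x; rewrite !comp_lfunE !(adE Hlie) stable_f.
  rewrite (ltraceC (ad e \o P)%VF); apply/eqP; congr (ltrace _).
  by apply/lfunP=> x; rewrite !comp_lfunE !(adE Hlie) stable_e.
have /choice[kk kkP] : forall l, exists k : nat, S l -> l = - (k.+1%:R *: alpha).
  move=> l; case: (pselect (S l)) => [/asboolP[k E]|nS]; first by exists k.
  by exists 0%N.
have trPe : ltrace (ad (vsval ha) \o Pe)%VF = 2%:R.
  have -> : (ad (vsval ha) \o Pe = 2%:R *: Pe)%VF.
    apply/lfunP=> x; rewrite scale_lfunE comp_lfunE PeE (adE Hlie) (brZr Hlie) ewt aha.
    by rewrite !scalerA mulrC.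
  pose phi : 'Hom(L, F^o) := linfun (fun x => killing f x / kef : F^o).
  have phiE x : phi x = killing f x / kef.
    by apply: linear_linfunE => a u v; rewrite killingPr mulrDl -mulrA.
  rewrite linearZ /= (@ltrace_rank1 _ _ _ phi e) => [|x]; last by rewrite PeE /= phiE.
  by rewrite /= phiE killingC divff // mulr1.
have trPh : ltrace (ad (vsval ha) \o Ph)%VF = 0.
  have -> : (ad (vsval ha) \o Ph)%VF = 0; last exact: linear0.
  apply/lfunP=> x; rewrite comp_lfunE zero_lfunE PhE.
  by rewrite lfunZ (adE Hlie) (brxx Hlie) scaler0.
have trS : ltrace (ad (vsval ha) \o qset S)%VF =
    - (2%:R * (\sum_(l <- ws | S l) (kk l).+1 * wdim l)%:R).
  rewrite comp_qset linear_sum /= natr_sum mulr_sumr -sumrN; apply: eq_bigr => l Sl.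
  transitivity (l ha * (wdim l)%:R : F); first exact: (ltrace_ad ha l).
  rewrite {1}(kkP l Sl) opp_lfunE scale_lfunE aha natrM.
  by rewrite -[_ *: _]/(_ * _) mulNr mulrA [2%:R * _]mulrC.
have wf : - alpha \in ws.
  apply: (mem_ws qf); apply: contraNneq kef_neq0 => f00.
  by rewrite /kef f00 killing0r.
split=> //.
move: tr0; rewrite !comp_lfunDr !linearD /= trPe trPh trS addr0 => /eqP.
rewrite subr_eq0 -{1}[2%:R]mulr1 (inj_eq (mulfI n2)) -[1]/(1%:R) => /eqP s1.
have {}s1 : (\sum_(l <- ws | S l) (kk l).+1 * wdim l)%N = 1%N.
  apply/eqP; move/eqP: s1; set s := (\sum_(_ <- _ | _) _)%N.
  case: s => [|s]; first by rewrite oner_eq0.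
  move=> /eqP E; have : s%:R + 1 = 0 + 1 :> F by rewrite natr1 add0r -E.
  by move/addIr/eqP; rewrite natf_eq0 // => /eqP ->.
(* A sum of naturals equal to 1 contains a positive multiple of [wdim (- alpha)], which is itself
   positive. *)
move: s1; rewrite -big_filter (bigD1_seq (- alpha)) /= ?mem_filter ?S1 ?filter_uniq ?(wdec_uniq W) //.
have : (0 < wdim (- alpha))%N by rewrite wdim_gt0.
case: (wdim (- alpha)) => [|[|d]] //.
Qed.

Lemma wdim1 (alpha : wt) : alpha \in ws -> alpha != 0 -> wdim alpha = 1%N.
Proof.
move=> wa a0; have [wa' _] := wdim_opp wa a0.
by rewrite -[alpha]opprK; apply: (wdim_opp wa' _).2; rewrite oppr_eq0.
Qed.

Lemma is_rootE (alpha : wt) : is_root br alpha <-> alpha \in [seq l <- ws | l != 0].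
Proof.
rewrite mem_filter; split=> [[a0 [x [x0 xa]]]|/andP[a0 wa]].
  rewrite a0; apply: (mem_ws (x := x)) => //; apply/gen_q => t; exists 1%N.
  by rewrite lpowSE lpow0E shfE // xa subrr.
have [e e0 [_ ewt]] := ex_weight_vector wa.
by split=> //; exists e.
Qed.

(** * Traces of the powers of the lift *)

Section Lift.
Variables (w : 'End(H)) (m : nat) (sigma : 'End(L)).
Hypotheses (m_gt0 : (0 < m)%N) (wm : lpow w m = \1%VF) (sm : lpow sigma m = \1%VF).
Hypothesis Hq : quasiregular br w m.
Hypothesis Hbr : forall u v, sigma (br u v) = br (sigma u) (sigma v).
Hypothesis Hlift : forall t : H, sigma (vsval t) = vsval (w t).

Lemma lpow_lift k t : lpow sigma k (vsval t) = vsval (lpow w k t).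
Proof. by elim: k => [|k IH]; rewrite ?lpow0E // !lpowSE IH Hlift. Qed.

Lemma lpow_br k x y : lpow sigma k (br x y) = br (lpow sigma k x) (lpow sigma k y).
Proof. by elim: k => [|k IH]; rewrite ?lpow0E // !lpowSE IH Hbr. Qed.

Lemma lpow_mod (V : vectType F) (f : 'End(V)) a r :
  lpow f m = \1%VF -> forall x : V, lpow f (a * m + r) x = lpow f r x.
Proof.
move=> fm x; elim: a => [|a IH]; first by rewrite mul0n.
by rewrite mulSn -addnA lpowDE fm id_lfunE.
Qed.

(** By Bezout, a root fixed by [w^k] is fixed by [w^(gcd k m)], whose exponent is a proper divisor
    of [m]. *)
Lemma quasiregular_lpow k (l : wt) : (0 < k < m)%N -> is_root br l ->
  (l \o lpow w k)%VF != l.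
Proof.
move=> /andP[k0 km] lr; apply/eqP=> lk.
have lkE t : l (lpow w k t) = l t by rewrite -[in RHS]lk comp_lfunE.
have lkM a t : l (lpow w (a * k) t) = l t.
  by elim: a t => [|a IH] t; rewrite ?lpow0E // mulSn lpowDE lkE IH.
have gm : (gcdn k m < m)%N by rewrite (leq_ltn_trans _ km) // dvdn_leq ?dvdn_gcdl.
have /eqP := Hq (dvdn_gcdr k m) gm lr; apply; apply/lfunP=> t; rewrite comp_lfunE.
have [a b ab _] := egcdnP m k0.
by rewrite -(lkM a t) ab lpow_mod.
Qed.

(** [w^(m - k)] stands for the inverse of [w^k]: an automorphism carries the weight [l] to
    [l \o w^(- k)]. *)
Lemma lpow_gen k l x : (k <= m)%N -> q l x = x ->
  q (l \o lpow w (m - k))%VF (lpow sigma k x) = lpow sigma k x.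
Proof.
move=> km /gen_q gx; apply/gen_q => t; have [j xj] := gx (lpow w (m - k) t).
exists j; rewrite comp_lfunE; set a := l _ in xj *.
suff -> i : lpow (shf br (vsval t) a) i (lpow sigma k x) =
    lpow sigma k (lpow (shf br (vsval (lpow w (m - k) t)) a) i x).
  by rewrite xj linear0.
elim: i => [|i IH]; first by rewrite !lpow0E.
rewrite !lpowSE IH !(shfE Hlie) linearB /= lfunZ lpow_br -lpow_lift.
by rewrite -lpowDE subnKC // sm id_lfunE.
Qed.

Lemma root_trace0 k l : (0 < k < m)%N -> l \in ws -> l != 0 ->
  ltrace (lpow sigma k \o q l)%VF = 0.
Proof.
move=> /andP[k0 km] wl l0; apply: ltrace_q0 => x qx.
apply: (@q_orth _ (l \o lpow w (m - k))%VF); last by apply: lpow_gen; rewrite // ltnW.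
rewrite eq_sym quasiregular_lpow //; last by apply/is_rootE; rewrite mem_filter l0.
by rewrite subn_gt0 km ltn_subrL k0 m_gt0.
Qed.

(** [q 0] factors as [L -> h -> L], and cyclicity of the trace moves the computation to [h]. *)
Lemma ltrace_lift k : ltrace (lpow sigma k \o q 0)%VF = ltrace (lpow w k).
Proof.
pose iota : 'Hom(H, L) := linfun vsval; pose pi : 'Hom(L, H) := (linfun (vsproj h) \o q 0)%VF.
have iE t : iota t = vsval t by rewrite lfunE.
have piE x : pi x = vsproj h (q 0 x) by rewrite comp_lfunE lfunE.
have ipi x : iota (pi x) = q 0 x.
  by rewrite iE piE vsprojK //; apply/q_0E; rewrite qq.
have -> : (lpow sigma k \o q 0 = (lpow sigma k \o iota) \o pi)%VF.
  by apply/lfunP=> x; rewrite comp_lfunE -ipi [RHS]comp_lfunE [RHS]comp_lfunE.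
rewrite ltraceC; congr (ltrace _); apply/lfunP=> t; rewrite !comp_lfunE iE lpow_lift.
by rewrite lfunE /= q0_val vsvalK.
Qed.

Lemma dim_fixedSpace_lift :
  (m * \dim (fixedSpace sigma) =
    m * \dim (fixedSpace w) + size [seq l <- ws | l != 0%R])%N.
Proof.
apply: natf_inj => //.
rewrite natrD !natrM !(dim_fixedSpace charF0 m_gt0) //.
have trE k : ltrace (lpow sigma k) = ltrace (lpow w k) +
    \sum_(l <- ws | l != 0) ltrace (lpow sigma k \o q l)%VF.
  rewrite ltrace_sum -ltrace_lift (bigID (pred1 0)) /=; congr (_ + _).
  rewrite big_mkcond (sum_delta (i := 0)) ?(wdec_uniq W) ?eqxx //.
    move=> /(wdec_out W) ->; have -> : (lpow sigma k \o 0)%VF = 0 :> 'End(L).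
      by apply/lfunP=> x; rewrite comp_lfunE !zero_lfunE linear0.
    by rewrite linear0.
  by move=> l /negPf ->.
under eq_bigr do rewrite trE.
rewrite big_split /=; congr (_ + _).
(* Only [k = 0] contributes on the root spaces, and there each one contributes its dimension 1. *)
case: (m) m_gt0 root_trace0 => // m' _ rt0; rewrite big_ord_recl /= [X in _ + X]big1 ?addr0 => [|i _].
  rewrite -sum1_size big_filter natr_sum [LHS]big_seq_cond [RHS]big_seq_cond.
  apply: eq_bigr => l /andP[wl l0].
  have -> : (lpow sigma (ord0 : 'I_m'.+1) \o q l)%VF = q l by exact: comp_lfun1l.
  by rewrite ltrace_q wdim1.
rewrite big_seq_cond big1 // => l /andP[wl l0]; apply: (rt0 i.+1) => //.
by rewrite ltnS; apply: ltn_ord.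
Qed.

End Lift.

End WeightSpaces.

Theorem theorem7p6
  (F : closedFieldType) (charF0 : [pchar F] =i pred0)
  (L : vectType F) (br : L -> L -> L)
  (Hlie : lie_bracket br) (Hsimple : simple_lie br)
  (h : {vspace L}) (Hcartan : cartan_subalgebra br h)
  (w : 'End(subvs_of h)) (m : nat)
  (Hw : in_weyl br w) (Hord : has_order w m) (Hq : quasiregular br w m)
  (sigma : 'End(L)) (Hsig : in_adjoint_group br sigma)
  (Hnorm : (sigma @: h <= h)%VS)
  (Hlift : forall t : subvs_of h, sigma (vsval t) = vsval (w t))
  (Hsord : has_order sigma m) :
  forall roots : seq 'Hom(subvs_of h, F^o),
    uniq roots -> (forall alpha, alpha \in roots <-> is_root br alpha) ->
    (size roots)%:R / m%:R =
      (\dim (fixedSpace sigma))%:R - (\dim (fixedSpace w))%:R :> rat.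
Proof.
move=> roots uroots rootsE.
have [m_gt0 [wm _]] := Hord; have [_ [sm _]] := Hsord.
have [Hnil _] := Hcartan.
have [ws0 [q W0]] : exists ws q, wdec br \1%VF ws q (h := h).
  by apply: weight_decomposition => // [x|t x]; rewrite !id_lfunE.
have W := wdec_filter W0; set ws := [seq l <- ws0 | _] in W.
have wsE l : (l \in ws) = (q l != 0).
  rewrite mem_filter; case: eqP => //= q0.
  by apply/negP => /negP/(wdec_out W0).
have Hbr := adjoint_group_morph charF0 Hlie _ _ Hsig.
have dimE := dim_fixedSpace_lift charF0 Hlie Hcartan W wsE Hsimple m_gt0 wm sm Hq
  (fun u v => Hbr u v) Hlift.
have -> : size roots = size [seq l <- ws | l != 0].
  apply/perm_size/uniq_perm; rewrite ?filter_uniq ?(wdec_uniq W0) // => l.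
  have R := is_rootE charF0 Hlie Hcartan W wsE l.
  by apply/idP/idP => [/rootsE/R|/R/rootsE].
have mQ : (m%:R : rat) != 0 by rewrite Num.Theory.pnatr_eq0 -lt0n.
apply: (mulfI mQ); rewrite mulrCA divff // mulr1 mulrBr -!natrM dimE natrD.
by rewrite addrAC subrr add0r.
Qed.
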